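(* Let $m>1$ be an integer with $m\not\equiv 2\pmod 4$. Suppose $f,g:U_m\to\mathbb{Z}$ are even functions (i.e. $f(-h)=f(h)$ and $g(-h)=g(h)$ for all $h\in U_m$) such that $\sum_{h\in U_m}f(h)=\sum_{h\in U_m}g(h)$. If \[\prod_{h\in U_m}(x^h-1)^{f(h)}\equiv\prod_{h\in U_m}(x^h-1)^{g(h)}\pmod{\tfrac{x^m-1}{x-1}},\] then $f=g$.
   Context: $U_m=(\mathbb{Z}/m\mathbb{Z})^\times$. The products are taken in the ring $\mathbb{Q}[x]/(C_m(x))$ with $C_m(x)=\frac{x^m-1}{x-1}=1+x+\cdots+x^{m-1}$; for $h\in U_m$, $x^h$ is computed using any integer representative of $h$ (well defined since $x^m\equiv 1$), and $x^h-1$ is a unit in this ring, so negative exponents make sense. *)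

(* Defs.v *)
From HB Require Import structures.
From mathcomp Require Import all_boot all_order all_fingroup all_algebra.

Set Implicit Arguments.
Unset Strict Implicit.
Unset Printing Implicit Defensive.

Import GRing.Theory Num.Theory.
Local Open Scope ring_scope.

Definition Cpoly (m : nat) : {poly rat} := \sum_(i < m) 'X^i.

(* [{poly %/ p}] is Q[x]/(p) only for [p] monic of size > 1, which
   [mk_monic_Cpoly] below establishes for [Cpoly m] when [m > 1]. *)
Definition xC (m : nat) : {poly %/ Cpoly m} := in_qpoly (Cpoly m) 'X.

Definition oppu (m : nat) (h : {unit 'Z_m}) : {unit 'Z_m} :=
  FinRing.unit 'Z_m (etrans (unitrN (val h)) (valP h)).

Definition even_fun (m : nat) (f : {ffun {unit 'Z_m} -> int}) : Prop :=
  forall h, f (oppu h) = f h.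

(* [x ^ h - 1], with [x ^ h] computed from the representative of [h] in [0, m);
   by [xC_expm] and [cycfac_unit] below, any other representative gives the same
   element, which is a unit when [m > 1]. *)
Definition cycfac (m : nat) (h : {unit 'Z_m}) : {poly %/ Cpoly m} :=
  xC m ^+ (val h : nat) - 1.

Lemma Cpoly_mulX1 m : ('X - 1) * Cpoly m = 'X^m - 1.
Proof. by rewrite subrX1. Qed.

Lemma Cpoly_div m : Cpoly m = ('X^m - 1) %/ ('X - 1).
Proof.
by rewrite -Cpoly_mulX1 mulKp // -[X in 'X - X]polyC1 polyXsubC_eq0.
Qed.

Lemma CpolyE m : Cpoly m = \poly_(i < m) 1.
Proof. by rewrite poly_def; apply: eq_bigr => i _; rewrite scale1r. Qed.

Lemma mk_monic_Cpoly m : (1 < m)%N -> mk_monic (Cpoly m) = Cpoly m.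
Proof.
case: m => // m m_gt1; have sC : size (Cpoly m.+1) = m.+1.
  by rewrite CpolyE size_poly_eq ?oner_eq0.
rewrite /mk_monic ifT // sC m_gt1 monicE lead_coefE sC CpolyE coef_poly /=.
by rewrite ltnSn eqxx.
Qed.

Lemma in_qpoly_Cpoly m : (1 < m)%N -> in_qpoly (Cpoly m) (Cpoly m) = 0.
Proof.
move=> m_gt1; apply: val_inj; rewrite /= mk_monic_Cpoly //.
by apply: Pdiv.Ring.rmodpp; apply: mulrC.
Qed.

Lemma xC_expm m : (1 < m)%N -> xC m ^+ m = 1.
Proof.
move=> m_gt1; apply/eqP; rewrite -subr_eq0 /xC -rmorphXn /= -in_qpoly1 -raddfB /=.
by rewrite -Cpoly_mulX1 in_qpolyM in_qpoly_Cpoly // mulr0.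
Qed.

Lemma cycfac_unit m (h : {unit 'Z_m}) :
  (1 < m)%N -> cycfac h \is a GRing.unit.
Proof.
rewrite /cycfac.
move=> m_gt1; have X1_unit : xC m - 1 \is a GRing.unit.
  rewrite /xC -in_qpoly1 -raddfB /=.
  have [q Eq] : exists q, Cpoly m - m%:R = q * ('X - 1).
    have /factor_theorem[q] : root (Cpoly m - m%:R) 1.
      rewrite /root hornerD hornerN -polyC_natr hornerC horner_sum.
      under eq_bigr do rewrite hornerXn expr1n.
      by rewrite sumr_const card_ord subrr.
    by rewrite polyC1 => ->; exists q.
  have m_unit : (m%:R : {poly %/ Cpoly m}) \is a GRing.unit.
    apply/unitrP; exists (m%:R^-1 *: 1); split;
    rewrite ?mulr_algl ?mulr_algr -scaler_nat scalerA ?mulVf ?scale1r //;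
    by rewrite pnatr_eq0 -lt0n ltnW.
  have := congr1 (in_qpoly (Cpoly m)) Eq.
  rewrite raddfB /= in_qpoly_Cpoly // sub0r in_qpolyM rmorph_nat => E.
  have : (- m%:R : {poly %/ Cpoly m}) \is a GRing.unit by rewrite unitrN.
  by rewrite E unitrM => /andP[].
have [k Ek] : exists k, (val h * k = 1 %[mod m])%N.
  exists (val (val h)^-1).
  suff E n : (Zp_trunc m).+2 = n -> (val h * val (val h)^-1 = 1 %[mod n])%N.
    by apply: E; apply: Zp_cast.
  by move=> <-; have /(congr1 val) := divrr (valP h).
have : xC m ^+ (val h * k) - 1 \is a GRing.unit.
  rewrite (_ : xC m ^+ _ = xC m) // (divn_eq (val h * k) m) Ek exprD mulnC.
  by rewrite exprM xC_expm // expr1n mul1r modn_small.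
by rewrite exprM subrX1 unitrM => /andP[].
Qed.

(* Main.v *)
Require Import Defs.
From mathcomp Require Import all_boot all_order all_fingroup all_algebra.
From mathcomp Require Import cyclic separable cyclotomic complex.
From mathcomp Require Import reals topology normedtype sequences derive realfun exp.
From mathcomp Require Import Rstruct.
From mathcomp Require Import zify ring lra.

(** Put D = f - g and F(n) = D(n^-1) on residues prime to m, F(n) = 0 elsewhere.
    Evaluating the relation at all nontrivial m-th roots of unity and taking
    logarithms of absolute values, then expanding -log|1 - r w| as the series of
    r^n Re(w^n)/n, inverting the finite Fourier transform and letting r tend
    to 1, one gets sum_n F(kn)/n = 0 for every k; this uses that D is even with
    sum zero.

    It remains to see that such an F vanishes, which is Dirichlet's theorem
    L(1, chi) <> 0; it is proved here without characters.  By Moebius inversion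
    and the Chebyshev-Mertens bounds,
      F(k) log N + sum_(n <= N) F(kn) Lambda(n)/n = O(1).
    Pairing this with F(k) shows that F(n .) = - F for all n prime to m outside a
    set of classes whose Lambda(n)/n have bounded sum.  A balanced function E
    invariant under the stabilizer of {F, -F} then satisfies both
    sum_n E(kn)/n = 0 and E(kn) = E(k) for almost all n in this sense, hence
    E = 0; so the stabilizer is everything and F is a multiple of a real
    character, for which Monsky's Lambert series argument applies. *)

Set Implicit Arguments.
Unset Strict Implicit.
Unset Printing Implicit Defensive.

Import Order.TTheory GRing.Theory Num.Theory.
Import numFieldNormedType.Exports.
Local Open Scope ring_scope.

(** * Divisor sums, the Moebius and von Mangoldt functions *)

Section DivisorSums.
Variable V : nmodType.

Lemma big_divisors (n : nat) (f : nat -> V) : (0 < n)%N ->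
  \sum_(d <- divisors n) f d = \sum_(1 <= d < n.+1 | (d %| n)%N) f d.
Proof.
move=> n0; rewrite -[RHS]big_filter; apply: perm_big; apply: uniq_perm.
- exact: divisors_uniq.
- by rewrite filter_uniq // iota_uniq.
move=> d; rewrite mem_filter -dvdn_divisors // mem_index_iota.
case: (boolP (d %| n)%N) => //= dn.
by rewrite (dvdn_gt0 n0 dn) ltnS dvdn_leq.
Qed.

(** Both sides run over the pairs (d, e) with d e <= N. In the induction, [N %/ d] grows by one
    exactly when d divides N + 1. *)
Lemma dirichlet_exchange (N : nat) (f : nat -> nat -> V) :
  \sum_(1 <= n < N.+1) \sum_(d <- divisors n) f d (n %/ d)%N =
  \sum_(1 <= d < N.+1) \sum_(1 <= e < (N %/ d).+1) f d e.
Proof.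
elim: N => [|N IH]; first by rewrite !big_geq.
rewrite big_nat_recr //= IH big_divisors // [in RHS]big_nat_recr //=.
rewrite divnn /= big_nat1 [X in _ + X]big_mkcond big_nat_recr //= dvdnn divnn /=.
rewrite addrA -big_split /=; congr (_ + _); apply: eq_big_nat => d /andP[d0 _].
rewrite divnS //; case: (d %| N.+1)%N => /=; last by rewrite addr0 add0n.
by rewrite add1n [RHS]big_nat_recr.
Qed.

Lemma big_divisors_primeX (p a n : nat) (f : nat -> V) :
    prime p -> ~~ (p %| n)%N -> (0 < n)%N ->
  \sum_(d <- divisors (p ^ a * n)) f d =
  \sum_(0 <= i < a.+1) \sum_(d <- divisors n) f (p ^ i * d)%N.
Proof.
move=> pp pn n0; have p0 := prime_gt0 pp.
transitivity (\sum_(d <- [seq (p ^ i * d)%N | i <- index_iota 0 a.+1, d <- divisors n]) f d);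
  last by rewrite big_allpairs_dep.
have an0 : (0 < p ^ a * n)%N by rewrite muln_gt0 expn_gt0 p0.
have lp i d : (d %| n)%N -> logn p (p ^ i * d) = i.
  move=> dn; have d0 := dvdn_gt0 n0 dn.
  rewrite lognM ?expn_gt0 ?p0 // pfactorK // [logn p d]lognE pp d0 /=.
  by case: ifP => [pd|]; rewrite ?addn0 //; rewrite (dvdn_trans pd dn) in pn.
apply: perm_big; apply: uniq_perm; first exact: divisors_uniq.
  apply: allpairs_uniq; rewrite ?iota_uniq ?divisors_uniq //.
  move=> [i d] [j e] /allpairsPdep[i'][d'][_ Hd [-> ->]].
  move=> /allpairsPdep[j'][e'][_ He [-> ->]] /= E.
  move: Hd He; rewrite -!dvdn_divisors // => Hd He.
  have Eij : i' = j' by rewrite -(lp i' d') // E lp.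
  by move/eqP: E; rewrite Eij eqn_pmul2l ?expn_gt0 ?p0 // => /eqP ->.
move=> d; rewrite -dvdn_divisors //; apply/idP/allpairsPdep.
  move=> dd; have d0 := dvdn_gt0 an0 dd.
  exists (logn p d), (d %/ p ^ logn p d)%N.
  have pd : (p ^ logn p d %| d)%N by rewrite pfactor_dvdnn.
  rewrite mulnC divnK // -dvdn_divisors // mem_index_iota /= ltnS; split=> //.
    by rewrite -(lp a n) //; apply: dvdn_leq_log.
  have cop : coprime (d %/ p ^ logn p d) (p ^ a).
    rewrite coprime_sym coprimeXl // prime_coprime //.
    have [q pq Eq] := pfactor_coprime pp d0.
    by rewrite {1}Eq mulnK ?expn_gt0 ?p0 // -prime_coprime.
  by rewrite -(Gauss_dvdr _ cop); apply: dvdn_trans dd; apply/dvdnP;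
    exists (p ^ logn p d)%N; rewrite mulnC divnK.
move=> [j][e][]; rewrite mem_index_iota /= ltnS -dvdn_divisors // => ja en ->.
by rewrite dvdn_mul // dvdn_exp2l.
Qed.

End DivisorSums.

(** Induction along the factorization, splitting off the full power of one prime. With
    [big_divisors_primeX] it lets divisor sums be computed one prime at a time. *)
Lemma prime_power_ind (P : nat -> Prop) :
  P 1%N ->
  (forall p a n, prime p -> (0 < a)%N -> ~~ (p %| n)%N -> (0 < n)%N ->
     P n -> P (p ^ a * n)%N) ->
  forall n, (0 < n)%N -> P n.
Proof.
move=> P1 PM; elim/ltn_ind => n IH n0.
have [->//|n1] := eqVneq n 1%N.
have n_gt1 : (1 < n)%N by lia.
have pp := pdiv_prime n_gt1; set p := pdiv n in pp.
have [q pq Eq] := pfactor_coprime pp n0.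
have l0 : (0 < logn p n)%N by rewrite logn_gt0 mem_primes pp n0 pdiv_dvd.
have q0 : (0 < q)%N by case: q Eq {pq} => // En; move: n0; rewrite En mul0n.
rewrite Eq mulnC; apply: PM => //; first by rewrite -prime_coprime.
apply: IH => //; rewrite Eq -{1}[q]muln1 ltn_pmul2l //.
by rewrite -(exp1n (logn p n)) ltn_exp2r // prime_gt1.
Qed.

Section Mobius.
Variable R : realType.

Definition mobius (n : nat) : R :=
  \prod_(p <- primes n) (if logn p n == 1%N then -1 else 0).

Lemma mobius_bound n : `|mobius n| <= 1.
Proof.
rewrite /mobius; elim/big_ind: _ => [|x y Hx Hy|p _].
- by rewrite normr1.
- by rewrite normrM mulr_ile1.
- by case: ifP => _; rewrite ?normrN ?normr1 ?normr0 ?ler01.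
Qed.

Lemma mobius_primeX p i d : prime p -> ~~ (p %| d)%N -> (0 < d)%N ->
  mobius (p ^ i.+1 * d) = if i == 0%N then - mobius d else 0.
Proof.
move=> pp pd d0; have p0 := prime_gt0 pp.
have pi0 : (0 < p ^ i.+1)%N by rewrite expn_gt0 p0.
have ld : logn p d = 0%N by rewrite lognE pp d0 /= (negPf pd).
rewrite /mobius (perm_big (p :: primes d)).
  rewrite big_cons lognM // pfactorK // ld addn0 eqSS.
  case: ifP => _; last by rewrite /= mul0r.
  rewrite /= mulN1r; congr (- _); apply: eq_big_seq => q.
  rewrite mem_primes => /and3P[qq _ qd].
  rewrite lognM // lognX [logn q p]logn_prime //.
  have /negPf-> : q != p by apply: contraNneq pd => <-.
  by rewrite muln0.
apply: uniq_perm; rewrite ?primes_uniq //= ?primes_uniq ?andbT //.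
  by rewrite mem_primes (negPf pd) !andbF.
move=> q; rewrite in_cons primesM // primesX // primes_prime //.
by rewrite !inE.
Qed.

Lemma mobius1 : mobius 1 = 1.
Proof. by rewrite /mobius big_nil. Qed.

(** Among the divisors p^i d only those with i = 0 or 1 survive, and the latter carry the opposite
    sign. *)
Lemma sum_mobius_primeX p a n (f : nat -> R) :
    prime p -> (0 < a)%N -> ~~ (p %| n)%N -> (0 < n)%N ->
  \sum_(d <- divisors (p ^ a * n)) mobius d * f d =
  \sum_(d <- divisors n) mobius d * (f d - f (p * d)%N).
Proof.
move=> pp a0 pn n0; rewrite big_divisors_primeX //.
case: a a0 => // a _; rewrite big_nat_recl // big_nat_recl //=.
rewrite [X in _ + (_ + X)]big1_seq ?addr0.
  rewrite -big_split /=; apply: eq_big_seq => d; rewrite -dvdn_divisors // => dn.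
  rewrite mobius_primeX ?(dvdn_gt0 n0) //=; first by rewrite expn0 expn1 mul1n; ring.
  by apply: contra pn => /dvdn_trans ->.
move=> i _; apply: big1_seq => d /=; rewrite -dvdn_divisors // => dn.
rewrite mobius_primeX ?(dvdn_gt0 n0) //= ?mul0r //.
by apply: contra pn => /dvdn_trans ->.
Qed.

Lemma sum_mobius n : (0 < n)%N ->
  \sum_(d <- divisors n) mobius d = (n == 1%N)%:R.
Proof.
move: n; apply: prime_power_ind => [|p a n pp a0 pn n0 _].
  by rewrite big_seq1 mobius1.
have := sum_mobius_primeX (fun=> 1) pp a0 pn n0.
under eq_bigr do rewrite mulr1.
move=> ->; rewrite big1 => [|d _]; last by rewrite subrr mulr0.
have : (1 < p ^ a * n)%N.
  have := ltn_expl a (prime_gt1 pp); nia.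
by case: eqP => // ->.
Qed.

(** Moebius inversion of log n = sum_(d | n) Lambda(d), taken as the definition. The usual
    description by prime powers follows from [mangoldt_primeX]. *)
Definition mangoldt (n : nat) : R :=
  - \sum_(d <- divisors n) mobius d * ln (d%:R : R).

(** In [sum_mobius_primeX] the difference log d - log (p d) is the constant -log p, which leaves the
    Moebius sum over the divisors of n. *)
Lemma mangoldt_primeX p a n :
    prime p -> (0 < a)%N -> ~~ (p %| n)%N -> (0 < n)%N ->
  mangoldt (p ^ a * n) = if n == 1%N then ln (p%:R : R) else 0.
Proof.
move=> pp a0 pn n0; rewrite /mangoldt sum_mobius_primeX //.
under eq_big_seq => d.
  rewrite -dvdn_divisors // => dn.
  rewrite natrM lnM ?posrE ?ltr0n ?(prime_gt0 pp) ?(dvdn_gt0 n0) //.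
  rewrite opprD addrCA subrr addr0 mulrN mulrC -mulNr.
  over.
rewrite -big_distrr /= sum_mobius // mulNr opprK.
by case: ifP; rewrite ?mulr1 ?mulr0.
Qed.

Lemma mangoldt1 : mangoldt 1 = 0.
Proof. by rewrite /mangoldt big_seq1 ln1 mulr0 oppr0. Qed.

Lemma mangoldt_ge0 n : 0 <= mangoldt n.
Proof.
(* [divisors 0] consists of 1 alone, so the value at 0 is 0. *)
have [->|] := posnP n; first by rewrite /mangoldt big_seq1 mobius1 ln1 mulr0 oppr0.
move: n; apply: prime_power_ind => [|p a n pp a0 pn n0 _]; first by rewrite mangoldt1.
rewrite mangoldt_primeX //; case: ifP => // _.
by rewrite ln_ge0 // ler1n prime_gt0.
Qed.

(** Passing from n to p^a n adds the divisors p^i d with i >= 1, of which only p, ..., p^a count,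
    each with log p. *)
Lemma sum_mangoldt n : (0 < n)%N ->
  \sum_(d <- divisors n) mangoldt d = ln (n%:R : R).
Proof.
move: n; apply: prime_power_ind => [|p a n pp a0 pn n0 IH].
  by rewrite big_seq1 mangoldt1 ln1.
rewrite big_divisors_primeX // big_nat_recl //=.
under eq_bigr do rewrite expn0 mul1n.
rewrite IH natrM natrX lnM ?posrE ?exprn_gt0 ?ltr0n ?(prime_gt0 pp) //.
rewrite lnXn ?ltr0n ?(prime_gt0 pp) // addrC; congr (_ + _).
rewrite (eq_bigr (fun=> ln (p%:R : R))) => [|i _].
  by rewrite big_const_nat subn0 iter_addr addr0.
rewrite (bigD1_seq 1%N) ?divisors_uniq -?dvdn_divisors ?dvd1n //=.
rewrite big_seq_cond big1 ?addr0 ?mangoldt_primeX ?Euclid_dvd1 // => d.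
rewrite -dvdn_divisors // => /andP[dn d1].
rewrite mangoldt_primeX ?(negPf d1) ?(dvdn_gt0 n0 dn) //.
by apply: contra pn => /dvdn_trans ->.
Qed.

End Mobius.

(** * Chebyshev and Mertens upper bounds *)

Section Chebyshev.
Variable R : realType.
Local Notation Lam := (mangoldt R).

Lemma sum_ln N : \sum_(1 <= n < N.+1) ln (n%:R : R) = ln (N`!%:R : R).
Proof.
elim: N => [|N IH]; first by rewrite big_geq // ln1.
rewrite big_nat_recr //= IH factS natrM lnM ?posrE ?ltr0n ?fact_gt0 //.
exact: addrC.
Qed.

(** Legendre's formula for N!: sum log n = sum_(d | n) Lambda(d) over n <= N and exchange. *)
Lemma sum_mangoldt_floor N :
  \sum_(1 <= d < N.+1) Lam d * (N %/ d)%:R = ln (N`!%:R : R).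
Proof.
rewrite -sum_ln [RHS](eq_big_nat _ _ (F2 := fun n => \sum_(d <- divisors n) Lam d)).
  rewrite (dirichlet_exchange N (fun d _ => Lam d)).
  apply: eq_bigr => d _; rewrite sumr_const_nat subSS subn0.
  by rewrite mulr_natr.
by move=> n /andP[n0 _]; rewrite sum_mangoldt.
Qed.

Definition psi N : R := \sum_(1 <= d < N.+1) Lam d.

Lemma psi_le : {homo psi : x y / (x <= y)%N >-> x <= y}.
Proof.
move=> x y xy; rewrite /psi [leRHS](big_cat_nat (n := x.+1)) //=.
by rewrite lerDl sumr_ge0 // => i _; apply: mangoldt_ge0.
Qed.

Lemma bin_le_exp2 n k : ('C(n, k) <= 2 ^ n)%N.
Proof.
have [kn|nk] := leqP k n; last by rewrite bin_small.
rewrite -[2%N]/(1 + 1)%N expnDn (bigD1 (Ordinal (kn : (k < n.+1)%N))) //=.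
by rewrite !exp1n !muln1 leq_addr.
Qed.

(** Chebyshev's argument: floor(2N/d) - 2 floor(N/d) is nonnegative, and at least 1 for N < d <= 2N,
    so the left side is at most the logarithm of the central binomial coefficient, hence at most 2N
    log 2. *)
Lemma psi_double N : psi (N + N) - psi N <= ln 4 * N%:R.
Proof.
have -> : psi (N + N) - psi N = \sum_(1 <= d < (N + N).+1) Lam d * (N < d)%N%:R.
  rewrite /psi (big_cat_nat (n := N.+1)) ?ltnS ?leq_addr //=.
  rewrite addrAC subrr add0r.
  rewrite [RHS](big_cat_nat (n := N.+1)) ?ltnS ?leq_addr //=.
  rewrite [X in _ = X + _]big_nat_cond [X in _ = X + _]big1 ?add0r.
    by apply: eq_big_nat => d /andP[-> _]; rewrite mulr1.
  by move=> d /andP[/andP[_ dN] _]; rewrite ltnNge -ltnS dN mulr0.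
apply: (@le_trans _ _ (\sum_(1 <= d < (N + N).+1)
           Lam d * (((N + N) %/ d)%:R - 2 * (N %/ d)%:R))).
  rewrite big_nat_cond [X in _ <= X]big_nat_cond.
  apply: ler_sum => d /andP[/andP[d0 dN] _]; apply: ler_wpM2l; first exact: mangoldt_ge0.
  have H : ((N < d) + 2 * (N %/ d) <= (N + N) %/ d)%N.
    have [Nd|dN'] := ltnP N d; first by rewrite divn_small // divn_gt0; lia.
    rewrite add0n leq_divRL //; have := leq_trunc_div N d; lia.
  by rewrite lerBrDr -natrM -natrD ler_nat.
rewrite (eq_bigr (fun d => Lam d * ((N + N) %/ d)%:R - 2 * (Lam d * (N %/ d)%:R)));
  last by move=> d _; ring.
rewrite sumrB -big_distrr /= sum_mangoldt_floor.
have -> : \sum_(1 <= d < (N + N).+1) Lam d * (N %/ d)%:R = ln (N`!%:R : R).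
  rewrite -sum_mangoldt_floor (big_cat_nat (n := N.+1)) ?ltnS ?leq_addr //=.
  rewrite [X in _ + X]big_nat_cond [X in _ + X]big1 ?addr0 // => d /andP[/andP[Nd _] _].
  by rewrite divn_small // mulr0.
rewrite -(bin_fact (leq_addr N N)) addnK !natrM !lnM ?posrE ?mulr_gt0 ?ltr0n ?fact_gt0 ?bin_gt0 ?leq_addr //.
set a := ln N`!%:R; have -> (b : R) : b + (a + a) - 2 * a = b by ring.
rewrite (_ : ln 4 * N%:R = ln ((2 ^ (N + N))%:R : R)).
  by rewrite ler_ln ?posrE ?ltr0n ?expn_gt0 ?bin_gt0 ?leq_addr // ler_nat bin_le_exp2.
rewrite addnn -mul2n expnM natrX lnXn ?mulr_natr //.
Qed.

Lemma psi_linear : exists2 C : R, 0 <= C & forall N, psi N <= C * N%:R.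
Proof.
have l4 : 0 <= ln 4 :> R by rewrite ln_ge0 // ler1n.
(* With M = ceil(N/2), induction gives psi(N) <= psi(2M) <= (3 + 1) log 4 M <= 2 log 4 (N + 1), and
   2 (N + 1) <= 3 N once N >= 2. *)
exists (3 * ln 4); first lra.
elim/ltn_ind => N IH; have [N1|N2] := leqP N 1%N.
  apply: (@le_trans _ _ 0); last by rewrite !mulr_ge0.
  by apply: le_trans (psi_le N1) _; rewrite /psi big_nat1 mangoldt1.
set M := uphalf N.
have MN : (M < N)%N by rewrite /M uphalf_half; have := odd_double_half N; lia.
have NM : (N <= M + M)%N by rewrite /M uphalf_half; have := odd_double_half N; lia.
have MN1 : (2 * M <= N.+1)%N by rewrite /M uphalf_half; have := odd_double_half N; lia.
have := psi_le NM; have := psi_double M; have := IH _ MN.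
have : (2 * M)%:R <= N.+1%:R :> R by rewrite ler_nat.
have : 2%:R <= N%:R :> R by rewrite ler_nat.
rewrite -natr1 natrM; nra.
Qed.

(** Multiply by N and replace N/d by floor(N/d) + 1: the floors give log N! <= N log N, the ones
    give [psi N], which is O(N). *)
Lemma mertens_upper : exists2 C : R, 0 <= C &
  forall N, (0 < N)%N -> \sum_(1 <= d < N.+1) Lam d / d%:R <= ln (N%:R : R) + C.
Proof.
have [C C0 HC] := psi_linear; exists C => // N N0.
have N0' : 0 < N%:R :> R by rewrite ltr0n.
rewrite -(ler_pM2l N0') mulrDr.
apply: (@le_trans _ _ (\sum_(1 <= d < N.+1) Lam d * (N %/ d)%:R + psi N)).
  rewrite /psi -big_split /= big_distrr /= big_nat_cond [X in _ <= X]big_nat_cond.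
  apply: ler_sum => d /andP[/andP[d0 dN] _].
  rewrite mulrCA -{3}[Lam d]mulr1 -mulrDr; apply: ler_wpM2l; first exact: mangoldt_ge0.
  rewrite ler_pdivrMr ?ltr0n // natr1 -natrM ler_nat ltnW //.
  by rewrite -ltn_divLR.
apply: lerD; last by rewrite mulrC; apply: HC.
have -> : N%:R * ln N%:R = \sum_(1 <= d < N.+1) ln N%:R :> R.
  by rewrite sumr_const_nat subSS subn0 mulr_natl.
rewrite sum_mangoldt_floor -sum_ln.
rewrite big_nat_cond [X in _ <= X]big_nat_cond; apply: ler_sum => d /andP[/andP[d0 dN] _].
by rewrite ler_ln ?posrE ?ltr0n // ler_nat.
Qed.

(** A weak Stirling bound, N! >= (N/e)^N. The inductive step is N log(1 + 1/N) <= 1. *)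
Lemma sum_ln_div N : (0 < N)%N ->
  \sum_(1 <= d < N.+1) (ln (N%:R : R) - ln (d%:R : R)) <= N%:R.
Proof.
case: N => // N _; rewrite big_split /= sumrN sum_ln sumr_const_nat subSS subn0.
elim: N => [|N IH]; first by rewrite ln1 mul0rn subrr.
rewrite factS natrM lnM ?posrE ?ltr0n ?fact_gt0 //.
have : N.+1%:R * (ln (N.+2%:R : R) - ln (N.+1%:R : R)) <= 1.
  rewrite -ln_div ?posrE ?ltr0n // mulrC -ler_pdivlMr ?ltr0n // div1r.
  have -> : N.+2%:R / N.+1%:R = 1 + N.+1%:R^-1 :> R.
    by rewrite -[N.+2%:R]natr1 mulrDl divff ?pnatr_eq0 // div1r.
  apply: le_ln1Dx; apply: lt_le_trans (_ : 0 <= _); first by rewrite ltrN10.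
  by rewrite invr_ge0 ler0n.
move: IH; rewrite -[ln _ *+ N.+2]mulr_natl -[ln _ *+ N.+1]mulr_natl.
move: (ln _) (ln _) (ln _) => a b c.
have -> : N.+2%:R = N.+1%:R + 1 :> R by rewrite natr1.
lra.
Qed.

End Chebyshev.

(** * Abel summation and elementary limit arguments *)

Section RealSequences.
Variable R : realType.

Lemma abel_summation (a b : nat -> R) (p j : nat) :
  \sum_(p <= n < p + j) a n * b n =
  (\sum_(p <= n < p + j) a n) * b (p + j)%N +
  \sum_(p <= n < p + j) (\sum_(p <= i < n.+1) a i) * (b n - b n.+1).
Proof.
elim: j => [|j IH]; first by rewrite addn0 !big_geq // mul0r addr0.
rewrite addnS 4?big_nat_recr ?leq_addr //= IH; ring.
Qed.

(** Abel's inequality: after summation by parts the weights b (p + j) and b n - b n.+1 are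
    nonnegative and add up to b p. *)
Lemma abel_bound (a b : nat -> R) (B : R) (p q : nat) :
    (forall N, `|\sum_(p <= n < N) a n| <= B) ->
    (forall n, (p <= n)%N -> 0 <= b n.+1 <= b n) ->
  `|\sum_(p <= n < q) a n * b n| <= B * b p.
Proof.
move=> Ba mono.
have B0 : 0 <= B by apply: le_trans (Ba 0%N).
have b0 n : (p <= n)%N -> 0 <= b n by move=> /mono/andP[]; apply: le_trans.
have [qp|/ltnW pq] := leqP q p.
  by rewrite big_geq // normr0 mulr_ge0 ?b0.
rewrite -(subnKC pq) abel_summation; set j := (q - p)%N.
have -> : b p = b (p + j)%N + \sum_(p <= n < p + j) (b n - b n.+1).
  rewrite -(opprK (\sum_(_ <= _ < _) _)) -sumrN.
  under [X in _ - X]eq_bigr do rewrite opprB.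
  by rewrite telescope_sumr ?leq_addr //; ring.
rewrite mulrDr; apply: le_trans (ler_normD _ _) _; apply: lerD.
  by rewrite normrM ler_pM // ger0_norm ?b0 ?leq_addr.
rewrite big_distrr /=; apply: le_trans (ler_norm_sum _ _ _) _.
apply: ler_sum_nat => n /andP[pn _]; have /andP[_ bn] := mono n pn.
by rewrite normrM ler_pM // ger0_norm // subr_ge0.
Qed.

Lemma bernoulli (x : R) n : -1 <= x -> 1 + n%:R * x <= (1 + x) ^+ n.
Proof.
move=> x1; elim: n => [|n IH]; first by rewrite mul0r addr0 expr0.
rewrite exprS -natr1; apply: (@le_trans _ _ ((1 + x) * (1 + n%:R * x))).
  have n0 : 0 <= n%:R :> R by []. nra.
by apply: ler_wpM2l IH; lra.
Qed.

(** Replaces passing to the limit N -> oo when the error is O(1/N). *)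
Lemma le_of_le_add_div (a b c : R) (K : nat) :
  (forall N, (K <= N)%N -> a <= b + c / N.+1%:R) -> a <= b.
Proof.
move=> H; rewrite leNgt; apply/negP => ba.
have e0 : 0 < a - b by rewrite subr_gt0.
have [n Hn] : exists n : nat, c / (a - b) < n%:R.
  exists (Num.bound `|c / (a - b)|).
  exact: le_lt_trans (ler_norm _) (archi_boundP (normr_ge0 _)).
have := H (maxn K n) (leq_maxl _ _); rewrite leNgt => /negP; apply.
rewrite -ltrBrDl ltr_pdivrMr ?ltr0n //.
move: Hn; rewrite ltr_pdivrMr // mulrC => Hn; apply: lt_le_trans Hn _.
by apply: ler_wpM2l; [exact: ltW | rewrite ler_nat; lia].
Qed.

End RealSequences.

(** * Non-vanishing of L(1, chi) for a real character *)

Section RealCharacter.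
Variables (R : realType) (chi : nat -> R) (B C : R).
Hypothesis chi1 : chi 1 = 1.
Hypothesis chiM : forall a b, chi (a * b)%N = chi a * chi b.
Hypothesis chi_val : forall n, [\/ chi n = 0, chi n = 1 | chi n = -1].
Hypothesis chi_sum : forall N, `|\sum_(1 <= n < N) chi n| <= B.
(** L(1, chi) = 0, stated for partial sums with the rate that Abel summation provides. *)
Hypothesis chi_L : forall N, `|\sum_(1 <= n < N.+1) chi n / n%:R| <= C / N.+1%:R.

(** The power series coefficients of the Lambert series of chi, and the Dirichlet coefficients of
    zeta(s) L(s, chi). *)
Let r n := \sum_(d <- divisors n) chi d.

Let r_primeX p a n : prime p -> ~~ (p %| n)%N -> (0 < n)%N ->
  r (p ^ a * n) = (\sum_(0 <= i < a.+1) chi p ^+ i) * r n.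
Proof.
move=> pp pn n0; rewrite /r big_divisors_primeX // big_distrl /=.
apply: eq_bigr => i _; rewrite big_distrr /=; apply: eq_bigr => d _.
by rewrite chiM; congr (_ * _); elim: i => // i IH; rewrite expnS chiM IH exprS.
Qed.

(** Local factor of [r] at p^a: never negative, and at least 1 for even a. Hence [r_ge0] and
    [r_square]. *)
Let geom_ge c a : [\/ c = 0, c = 1 | c = -1] ->
  (~~ odd a)%:R <= \sum_(0 <= i < a.+1) c ^+ i :> R.
Proof.
case=> ->.
- rewrite big_nat_recl //= big1 => [|i _]; last by rewrite expr0n.
  by rewrite expr0 addr0 lern1 leq_b1.
- under eq_bigr do rewrite expr1n.
  rewrite sumr_const_nat subn0 ler_nat; case: (odd a) => //.
- suff -> : \sum_(0 <= i < a.+1) (-1) ^+ i = (~~ odd a)%:R :> R by [].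
  elim: a => [|a IH]; first by rewrite big_nat1.
  rewrite big_nat_recr //= IH -signr_odd /=.
  by case: (odd a); rewrite /= ?expr1 ?expr0 ?subrr ?add0r.
Qed.

Let r_ge0 n : (0 < n)%N -> 0 <= r n.
Proof.
move: n; apply: prime_power_ind => [|p a n pp a0 pn n0 IH].
  by rewrite /r big_seq1 chi1.
rewrite r_primeX // mulr_ge0 //; apply: le_trans (geom_ge _ (chi_val p)).
by rewrite ler0n.
Qed.

Let r_square n : (0 < n)%N -> 1 <= r (n ^ 2).
Proof.
move: n; apply: prime_power_ind => [|p a n pp a0 pn n0 IH].
  by rewrite /r big_seq1 chi1.
rewrite expnMn -expnM r_primeX ?expn_gt0 ?n0 //.
  apply: mulr_ege1 => //; have := geom_ge (a * 2) (chi_val p).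
  by rewrite oddM andbF.
by rewrite Euclid_dvdX // (negPf pn).
Qed.

Let sum_r_squares j : j%:R <= \sum_(1 <= n < (j ^ 2).+1) r n.
Proof.
elim: j => [|j IH]; first by rewrite big_geq.
rewrite (big_cat_nat (n := (j ^ 2).+1)) //=; last by rewrite ltnS leq_exp2r.
rewrite -natr1 lerD // big_nat_recr /=; last by rewrite ltn_exp2r.
rewrite (le_trans (r_square (ltn0Sn j))) // lerDr.
by rewrite big_nat_cond sumr_ge0 // => i /andP[/andP[ji _] _]; rewrite r_ge0; lia.
Qed.

Section Lambert.
Variable s : R.
Hypothesis s01 : 0 < s < 1.
(** The variable t of the Lambert series is written as a square so that the arithmetic-geometric
    mean inequality can be applied to t^i and t^(d-i). *)
Let t := s ^+ 2.
Let q d := \sum_(i < d) t ^+ i.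

Let s0 : 0 < s. Proof. by case/andP: s01. Qed.
Let s1 : s < 1. Proof. by case/andP: s01. Qed.
Let t0 : 0 < t. Proof. by rewrite exprn_gt0. Qed.
Let tX_ge0 k : 0 <= t ^+ k. Proof. by rewrite exprn_ge0 // ltW. Qed.
Let t1 : t < 1. Proof. by rewrite exprn_ilt1 // ltW. Qed.

(** Pair each term of [q] with its mirror image: t^i + t^(d-i) >= 2 s^d. *)
Let q_ge d : d.+1%:R * s ^+ d <= q d.+1.
Proof.
have E : q d.+1 + q d.+1 = \sum_(i < d.+1) (t ^+ i + t ^+ (d - i)).
  rewrite big_split /=; congr (_ + _); rewrite /q (reindex_inj rev_ord_inj) /=.
  by apply: eq_bigr => i _; rewrite subSS.
have : \sum_(i < d.+1) (2 * s ^+ d) <= q d.+1 + q d.+1.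
  rewrite E; apply: ler_sum => i _.
  have -> : s ^+ d = s ^+ i * s ^+ (d - i) by rewrite -exprD subnKC // -ltnS.
  rewrite /t -!exprM ![(2 * _)%N]mulnC !exprM.
  by have := sqr_ge0 (s ^+ i - s ^+ (d - i)); rewrite !expr2; nra.
rewrite sumr_const card_ord -mulr_natl; lra.
Qed.

Let q_gt0 d : 0 < q d.+1.
Proof. by apply: lt_le_trans (q_ge d); rewrite mulr_gt0 ?ltr0n ?exprn_gt0. Qed.

(** Since 1 - t^d = (1 - t) [q d], this is 1/d minus (1 - t) times the Lambert term t^d / (1 -
    t^d). *)
Let b d := d%:R^-1 - t ^+ d / q d.

(** The decrement at d is 1/(d(d+1)) - t^d / (q_d q_(d+1)). By [q_ge] the product q_d q_(d+1) is at
    least d(d+1) s^(2d-1), and s^(2d-1) >= t^d. *)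
Let b_mono n : (1 <= n)%N -> 0 <= b n.+1 <= b n.
Proof.
case: n => // n _; apply/andP; split.
  rewrite /b subr_ge0 ler_pdivrMr // mulrC ler_pdivlMr ?ltr0n //.
  rewrite mulrC mulr_natl -[leLHS](_ : \sum_(i < n.+2) t ^+ n.+2 = _).
    apply: ler_sum => i _; apply: ler_wiXn2l; rewrite ?ltW //.
    by rewrite ltnW.
  by rewrite sumr_const card_ord.
have Q0 := q_gt0 n; have Q1 := q_gt0 n.+1.
have qS' : q n.+2 = 1 + t * q n.+1.
  rewrite /q big_ord_recl expr0 big_distrr /=; congr (_ + _).
  by apply: eq_bigr => i _; rewrite -exprS.
have E : b n.+1 - b n.+2 =
    (n.+1%:R * n.+2%:R)^-1 - t ^+ n.+1 / (q n.+1 * q n.+2).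
  rewrite /b [t ^+ n.+2]exprS.
  have -> : t ^+ n.+1 / (q n.+1 * q n.+2) =
     t ^+ n.+1 * (q n.+2 - t * q n.+1) / (q n.+1 * q n.+2).
    by rewrite [q n.+2 - _](_ : _ = 1) ?mulr1 // qS' addrK.
  have -> : (n.+1%:R * n.+2%:R : R)^-1 = (n.+2%:R - n.+1%:R) / (n.+1%:R * n.+2%:R).
    by rewrite -[n.+2%:R in X in X / _]natr1 addrAC subrr add0r mul1r.
  have n0 : 0 <= n%:R :> R by [].
  by field; apply/and4P; split; rewrite gt_eqF //; lra.
rewrite -subr_ge0 E subr_ge0 ler_pdivrMr ?mulr_gt0 // mulrC ler_pdivlMr ?mulr_gt0 ?ltr0n //.
have := ler_pM _ _ (q_ge n) (q_ge n.+1).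
rewrite !mulr_ge0 ?exprn_ge0 ?(ltW s0) // => /(_ isT isT); apply: le_trans.
rewrite mulrACA [t ^+ _ * _]mulrC ler_wpM2l ?mulr_ge0 // -exprD /t -exprM.
by apply: ler_wiXn2l; rewrite ?ltW //; lia.
Qed.

Let one_sub_tX d : 1 - t ^+ d = (1 - t) * q d.
Proof.
rewrite /q -opprB subrX1 -mulNr opprB; congr (_ * _).
Qed.

(** Splitting the Lambert term as (1/d - b d)/(1 - t), the part with 1/d is negligible by [chi_L].
    The part with [b] is at most B b(1)/(1 - t) = B by Abel's inequality, since b(1) = 1 - t. *)
Let lambert_bound N :
  \sum_(1 <= d < N.+1) chi d * (t ^+ d / (1 - t ^+ d)) <=
  B + C / (1 - t) / N.+1%:R.
Proof.
have t1' : 0 < 1 - t by rewrite subr_gt0.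
have b1 : b 1 = 1 - t by rewrite /b /q big_ord1 expr0 divr1 invr1 expr1.
have := abel_bound N.+1 chi_sum b_mono; rewrite b1 => H.
have -> : \sum_(1 <= d < N.+1) chi d * (t ^+ d / (1 - t ^+ d)) =
   (1 - t)^-1 * (\sum_(1 <= d < N.+1) chi d / d%:R - \sum_(1 <= d < N.+1) chi d * b d).
  rewrite -sumrB big_distrr /=; apply: eq_bigr => d _.
  by rewrite one_sub_tX /b invfM; ring.
rewrite mulrC ler_pdivrMr // mulrDl.
have -> : C / (1 - t) / N.+1%:R * (1 - t) = C / N.+1%:R.
  by rewrite mulrAC divfK // gt_eqF.
have := chi_L N; move: H; rewrite !ler_norml => /andP[H1 _] /andP[_ H4].
by rewrite [leLHS]addrC; apply: lerD => //; rewrite lerNl.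
Qed.

Let geometric_sum (x : R) M : x != 1 ->
  \sum_(1 <= e < M.+1) x ^+ e = x / (1 - x) - x ^+ M.+1 / (1 - x).
Proof.
move=> x1; have nz : 1 - x != 0 by rewrite subr_eq0 eq_sym.
elim: M => [|M IH]; first by rewrite big_geq // expr1 subrr.
by rewrite big_nat_recr //= IH [in RHS]exprS; field.
Qed.

(** Bernoulli applied to 1/s gives s^N = O(1/N); squaring, t^N = O(1/N^2). The factor 2 accounts for
    N + 1 in place of N. *)
Let tail_bound : exists D, forall N, N%:R * t ^+ N / (1 - t) <= D / N.+1%:R.
Proof.
have t1' : 0 < 1 - t by rewrite subr_gt0.
pose x := s^-1 - 1; have x0 : 0 < x by rewrite subr_gt0 invf_gt1.
exists ((x ^+ 2)^-1 * 2 / (1 - t)) => N.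
rewrite [leRHS]mulrAC ler_wpM2r ?invr_ge0 ?(ltW t1') //.
case: N => [|N].
  by rewrite mul0r divr_ge0 // mulr_ge0 ?invr_ge0 ?sqr_ge0.
have Nx : 0 < N.+1%:R * x by rewrite mulr_gt0 ?ltr0n.
have sN : s ^+ N.+1 <= (N.+1%:R * x)^-1.
  rewrite -[s]invrK exprVn lef_pV2 ?posrE ?exprn_gt0 ?invr_gt0 //.
  have -> : s^-1 = 1 + x by rewrite /x addrC subrK.
  by apply: le_trans (bernoulli _ _); [rewrite lerDr | lra].
rewrite /t -exprM mulnC exprM.
have : (s ^+ N.+1) ^+ 2 <= (N.+1%:R * x)^-1 ^+ 2
  by rewrite ler_sqr ?nnegrE ?exprn_ge0 ?invr_ge0 ?(ltW s0) ?(ltW Nx).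
move/(ler_wpM2l (ler0n R N.+1)) => H; apply: le_trans H _.
rewrite exprVn exprMn invfM mulrA mulrC -mulrA ler_wpM2l ?invr_ge0 ?sqr_ge0 //.
have -> : N.+1%:R * (N.+1%:R ^+ 2)^-1 = N.+1%:R^-1 :> R.
  by rewrite expr2 invfM mulrA divff ?pnatr_eq0 // mul1r.
rewrite ler_pdivlMr ?ltr0n // mulrC ler_pdivrMr ?ltr0n // -natrM ler_nat; lia.
Qed.

(** Exchanging the sums up to N turns the left side into the Lambert series with each geometric
    series cut off. Each cut costs at most t^N/(1 - t), for a total controlled by [tail_bound]; then
    N -> oo. *)
Let abel_sum_r K : \sum_(1 <= n < K.+1) r n * t ^+ n <= B.
Proof.
have t1' : 0 < 1 - t by rewrite subr_gt0.
have [D HD] := tail_bound.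
apply: (@le_of_le_add_div _ _ _ (C / (1 - t) + D) K) => N KN.
apply: (@le_trans _ _ (\sum_(1 <= n < N.+1) r n * t ^+ n)).
  rewrite [leRHS](big_cat_nat (n := K.+1)) //= lerDl.
  rewrite big_nat_cond sumr_ge0 // => n /andP[/andP[n0 _] _].
  by apply: mulr_ge0; [apply: r_ge0; lia | rewrite tX_ge0].
rewrite mulrDl addrA; apply: le_trans (lerD (lambert_bound N) (HD N)).
rewrite (eq_big_nat _ _ (F2 := fun n => \sum_(d <- divisors n) chi d * t ^+ (d * (n %/ d)))).
  rewrite (dirichlet_exchange N (fun d e => chi d * t ^+ (d * e))).
  have -> : N%:R * t ^+ N / (1 - t) = \sum_(1 <= d < N.+1) t ^+ N / (1 - t).
    by rewrite sumr_const_nat subSS subn0 -mulrA mulr_natl.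
  rewrite -big_split /=; apply: ler_sum_nat => d /andP[d0 _].
  under eq_bigr do rewrite exprM.
  have td1 : t ^+ d < 1 by rewrite exprn_ilt1 ?(ltW t0) // -lt0n.
  rewrite -big_distrr /= geometric_sum ?lt_eqF // mulrBr lerD2l.
  apply: le_trans (ler_norm _) _; rewrite normrN normrM -exprM.
  have td1' : 0 < 1 - t ^+ d by rewrite subr_gt0.
  rewrite [X in _ * X]ger0_norm ?divr_ge0 ?tX_ge0 ?(ltW td1') //.
  apply: (@le_trans _ _ (1 * (t ^+ (d * (N %/ d).+1) / (1 - t ^+ d)))).
    apply: ler_wpM2r; first by rewrite divr_ge0 ?tX_ge0 ?(ltW td1').
    by case: (chi_val d) => ->; rewrite ?normrN ?normr0 ?normr1.
  rewrite mul1r ler_pM ?tX_ge0 ?invr_ge0 ?(ltW td1') //.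
    by apply: ler_wiXn2l; rewrite ?ltW // mulnC ltnW // ltn_ceil.
  rewrite lef_pV2 ?posrE // lerD2l lerN2 -[leRHS]expr1.
  by apply: ler_wiXn2l; rewrite ?ltW.
move=> n /andP[n0 _]; rewrite /r big_distrl /=; apply: eq_big_seq => d.
by rewrite -dvdn_divisors // => dn; rewrite mulnC divnK.
Qed.

Lemma lambert_squares j : j%:R * t ^+ (j ^ 2) <= B.
Proof.
apply: le_trans (abel_sum_r (j ^ 2)).
apply: (@le_trans _ _ (\sum_(1 <= n < (j ^ 2).+1) r n * t ^+ (j ^ 2))).
  by rewrite -big_distrl /= ler_wpM2r ?tX_ge0.
apply: ler_sum_nat => d /andP[d0 dN].
by rewrite ler_wpM2l ?r_ge0 //; apply: ler_wiXn2l; rewrite ?ltW.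
Qed.

End Lambert.

(* Monsky's proof: for L(1, chi) = 0 the Lambert series of chi stays bounded
   as t -> 1, whereas its coefficients are nonnegative and >= 1 at squares. *)
Lemma real_character_nonvanishing : False.
Proof.
have [j Hj] : exists j : nat, 2 * B < j%:R.
  exists (Num.bound `|2 * B|).
  exact: le_lt_trans (ler_norm _) (archi_boundP (normr_ge0 _)).
have B0 : 0 <= B by apply: le_trans (chi_sum 0).
have j0 : (0 < j)%N by rewrite -(ltr0n R); apply: le_lt_trans Hj; lra.
pose K := (j ^ 2)%N; have K0 : 0 < K%:R :> R by rewrite ltr0n expn_gt0 j0.
(* With s = 1 - y, Bernoulli gives t^K = (1 - y)^(2K) >= 1 - 2Ky = 1/2, so [lambert_squares] yields
   j/2 <= B, against the choice of j. *)
pose y : R := (4 * K%:R)^-1.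
have y0 : 0 < y by rewrite invr_gt0 mulr_gt0.
have K1 : 1 <= K%:R :> R by rewrite ler1n -(ltr0n R).
have y1 : y < 1 by rewrite invf_lt1 ?mulr_gt0 //; lra.
have s01 : 0 < 1 - y < 1 by apply/andP; split; lra.
have := lambert_squares s01 j; rewrite -/K -exprM.
have := @bernoulli R (- y) (2 * K); rewrite natrM.
have -> : 2 * K%:R * - y = - (1 / 2) by rewrite /y; field; rewrite gt_eqF.
have : 0 < j%:R :> R by rewrite ltr0n.
move=> ? Hb; have /Hb : -1 <= - y by lra.
nra.
Qed.

End RealCharacter.

(** * Periodic functions and their L-series at 1 *)

Section PeriodicFunctions.
Variables (R : realType) (m : nat).
Hypothesis m_gt0 : (0 < m)%N.
Implicit Types F : nat -> R.

Definition periodic F := forall n, F (n + m)%N = F n.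

(** These are the combinations of nontrivial Dirichlet characters modulo m. *)
Definition balanced F :=
  [/\ periodic F, forall n, ~~ coprime n m -> F n = 0
    & \sum_(i < m) F i = 0].

Lemma periodic_modn F n : periodic F -> F (n %% m)%N = F n.
Proof.
move=> pF; rewrite [in RHS](divn_eq n m) addnC.
elim: (n %/ m)%N => [|j IH]; first by rewrite mul0n addn0.
by rewrite mulSn addnCA addnC pF.
Qed.

Lemma periodic_congr F a b : periodic F -> a = b %[mod m] -> F a = F b.
Proof. by move=> pF ab; rewrite -(periodic_modn a) // ab periodic_modn. Qed.

Lemma periodic_mul F k : periodic F -> periodic (fun n => F (k * n)%N).
Proof.
by move=> pF n; apply: periodic_congr => //; rewrite mulnDr addnC modnMDl.
Qed.

Lemma periodic_bounded F : periodic F -> exists2 M, 0 <= M & forall n, `|F n| <= M.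
Proof.
move=> pF; exists (\sum_(i < m) `|F i|); first by rewrite sumr_ge0.
move=> n; rewrite -periodic_modn //.
rewrite (bigD1 (Ordinal (ltn_pmod n m_gt0))) //= lerDl.
by rewrite sumr_ge0.
Qed.

Lemma coprime_mulmod_inj k i j : coprime k m -> (i < m)%N -> (j < m)%N ->
  k * i = k * j %[mod m] -> i = j.
Proof.
move=> km; wlog ij : i j / (i <= j)%N => [H|].
  by case: (leqP i j) => [|/ltnW] ? ? ? ?; [|symmetry]; apply: H.
move=> im jm /eqP; rewrite eq_sym eqn_mod_dvd ?leq_mul2l ?ij ?orbT //.
rewrite -mulnBr Gauss_dvdr 1?coprime_sym // => /dvdn_leq H.
by apply/eqP; rewrite eqn_leq ij leqNgt; apply/negP => lt; have := H _; lia.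
Qed.

Lemma sum_mul_coprime F k : periodic F -> coprime k m ->
  \sum_(i < m) F (k * i)%N = \sum_(i < m) F i.
Proof.
move=> pF km; pose h (i : 'I_m) := Ordinal (ltn_pmod (k * i) m_gt0).
have h_inj : injective h.
  by move=> i j /(congr1 val) /= /coprime_mulmod_inj E; apply/val_inj/E.
rewrite [RHS](reindex_inj h_inj) /=.
by apply: eq_bigr => i _; rewrite periodic_modn.
Qed.

Lemma balanced_mul F k : balanced F -> balanced (fun n => F (k * n)%N).
Proof.
case=> pF sF zF; have F0 : ~~ coprime k m -> forall n, F (k * n)%N = 0.
  by move=> km n; rewrite sF // coprimeMl (negPf km).
split; first exact: periodic_mul.
  by move=> n nm; rewrite sF // coprimeMl (negPf nm) andbF.
have [km|/F0 E] := boolP (coprime k m); first by rewrite sum_mul_coprime.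
by rewrite big1 // => i _; rewrite E.
Qed.

(** Full periods cancel, so a sum from 0 reduces to fewer than m terms; a general range is a
    difference of two such sums. *)
Lemma balanced_partial_sums F M : balanced F -> (forall n, `|F n| <= M) ->
  forall p N, `|\sum_(p <= n < N) F n| <= 2 * (m%:R * M).
Proof.
case=> pF _ zF FM.
pose s N := \sum_(0 <= n < N) F n.
have sp : forall N, s (N + m)%N = s N.
  elim=> [|N IH]; first by rewrite /s add0n big_mkord zF big_geq.
  by rewrite addSn /s !big_nat_recr //= pF; congr (_ + _); apply: IH.
have s_le N : `|s N| <= m%:R * M.
  have -> : s N = s (N %% m)%N.
    rewrite {1}(divn_eq N m) addnC; elim: (N %/ m)%N => [|j IH].
      by rewrite mul0n addn0.
    by rewrite mulSn addnCA addnC sp.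
  have lt := ltn_pmod N m_gt0.
  apply: le_trans (ler_norm_sum _ _ _) _.
  apply: (@le_trans _ _ (\sum_(0 <= n < N %% m) M)); first by apply: ler_sum_nat.
  rewrite sumr_const_nat subn0 -[leLHS]mulr_natl; apply: ler_wpM2r.
    exact: le_trans (FM 0%N).
  by rewrite ler_nat ltnW.
move=> p N; have [Np|/ltnW pN] := leqP N p.
  rewrite big_geq // normr0 !mulr_ge0 //; exact: le_trans (FM 0%N).
have -> : \sum_(p <= n < N) F n = s N - s p.
  by rewrite /s [\sum_(0 <= n < N) _](big_cat_nat (n := p)) //= addrAC subrr add0r.
apply: le_trans (ler_normB _ _) _; have := s_le N; have := s_le p; lra.
Qed.

Definition Lsum F k N := \sum_(1 <= n < N.+1) F (k * n)%N / n%:R.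

(** Abel's inequality with weights 1/n. The constant is uniform in k because n -> F(kn) is again
    balanced with the same bound. *)
Lemma Lsum_tail F : balanced F -> exists2 B, 0 <= B &
  forall k N M, (N <= M)%N -> `|Lsum F k M - Lsum F k N| <= B / N.+1%:R.
Proof.
move=> bF; have [M M0 FM] := periodic_bounded (let: And3 p _ _ := bF in p).
exists (2 * (m%:R * M)); first by rewrite !mulr_ge0.
move=> k N N' NN'; rewrite /Lsum.
rewrite [\sum_(1 <= n < N'.+1) _](big_cat_nat (n := N.+1)) //= addrAC subrr add0r.
apply: (@abel_bound R (fun n => F (k * n)%N) (fun n => n%:R^-1)).
  exact: balanced_partial_sums (balanced_mul k bF) _ _.
by case=> // n _; rewrite invr_ge0 ler0n lef_pV2 ?posrE ?ltr0n // ler_nat leqnSn.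
Qed.

(** The series sum_n F(kn)/n vanish for all k; for balanced F the rate is automatic by
    [Lsum_tail]. *)
Definition Lvanish F := exists2 B, 0 <= B & forall k N, `|Lsum F k N| <= B / N.+1%:R.

Local Notation Lam := (mangoldt R).

Lemma sum_mobius_ln_div N n : (0 < n)%N ->
  \sum_(d <- divisors n) mobius R d * (ln (N%:R : R) - ln (d%:R : R)) =
  (n == 1%N)%:R * ln (N%:R : R) + Lam n.
Proof.
move=> n0; under eq_bigr do rewrite mulrBr.
by rewrite sumrB -big_distrl /= sum_mobius.
Qed.

Lemma div_floor_le (B : R) (N d : nat) : 0 <= B -> (0 < N)%N -> (0 < d)%N ->
  B / (N %/ d).+1%:R / d%:R <= B / N%:R.
Proof.
move=> B0 N0 d0; rewrite -mulrA; apply: ler_wpM2l => //.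
rewrite -invfM lef_pV2 ?posrE ?mulr_gt0 ?ltr0n // -natrM ler_nat.
by rewrite ltnW ?ltn_ceil.
Qed.

(* Sum F(kn)/n * sum_(d | n) mu(d) log(N/d) over n <= N in both orders. *)
Lemma Lvanish_mangoldt F : Lvanish F -> exists2 C, 0 <= C & forall k N, (0 < N)%N ->
  `|F k * ln (N%:R : R) + \sum_(1 <= n < N.+1) F (k * n)%N * (Lam n / n%:R)| <= C.
Proof.
move=> [B B0 HB]; exists B => // k N N0.
have N0' : 0 < N%:R :> R by rewrite ltr0n.
have -> : F k * ln (N%:R : R) + \sum_(1 <= n < N.+1) F (k * n)%N * (Lam n / n%:R) =
  \sum_(1 <= n < N.+1) \sum_(d <- divisors n)
    (mobius R d * (ln (N%:R : R) - ln (d%:R : R))) *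
    (F (k * (d * (n %/ d)))%N / (d * (n %/ d))%:R).
  transitivity (\sum_(1 <= n < N.+1)
      F (k * n)%N / n%:R * ((n == 1%N)%:R * ln (N%:R : R) + Lam n)).
    under [RHS]eq_bigr do rewrite mulrDr.
    rewrite big_split /= [X in _ = X + _]big_ltn // eqxx muln1 divr1 mul1r.
    rewrite [X in _ = _ + X + _]big_nat_cond [X in _ = _ + X + _]big1 ?addr0.
      by congr (_ + _); apply: eq_bigr => n _; rewrite mulrAC mulrA.
    by move=> n /andP[/andP[n1 _] _]; rewrite gtn_eqF // mul0r mulr0.
  apply: eq_big_nat => n /andP[n0 _]; rewrite -sum_mobius_ln_div // big_distrr /=.
  apply: eq_big_seq => d; rewrite -dvdn_divisors // => dn.
  by rewrite [(d * _)%N]mulnC divnK // mulrC.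
rewrite (dirichlet_exchange N (fun d e =>
    (mobius R d * (ln (N%:R : R) - ln (d%:R : R))) * (F (k * (d * e))%N / (d * e)%:R))).
(* For each d the sum over e is a vanishing L-sum cut at N/d, hence O(1/N) after division by d. The
   weights log(N/d) add up to at most N. *)
apply: (@le_trans _ _ (\sum_(1 <= d < N.+1) (ln (N%:R : R) - ln (d%:R : R)) * (B / N%:R))).
  apply: le_trans (ler_norm_sum _ _ _) _; apply: ler_sum_nat => d /andP[d0 dN].
  have -> : \sum_(1 <= e < (N %/ d).+1) mobius R d * (ln N%:R - ln d%:R) *
       (F (k * (d * e))%N / (d * e)%:R) =
     mobius R d * ((ln N%:R - ln d%:R) * (Lsum F (k * d) (N %/ d) / d%:R)).
    rewrite /Lsum !big_distrl !big_distrr /=; apply: eq_bigr => e _.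
    by rewrite mulnA natrM invfM; ring.
  have ln0 : 0 <= ln (N%:R : R) - ln (d%:R : R).
    by rewrite subr_ge0 ler_ln ?posrE ?ltr0n // ler_nat.
  rewrite normrM -[leRHS]mul1r ler_pM ?mobius_bound //.
  rewrite normrM ger0_norm // ler_wpM2l // normrM [`|_^-1|]ger0_norm ?invr_ge0 //.
  apply: le_trans (div_floor_le B0 N0 d0).
  by rewrite ler_wpM2r ?invr_ge0.
rewrite -big_distrl /= mulrCA -[leRHS]mulr1 ler_wpM2l //.
by rewrite ler_pdivrMr // mul1r sum_ln_div.
Qed.

(** Uses log n >= 1 and log(n + 1) <= log n + 1/n. The threshold 4 makes the first one elementary:
    log 4 = 2 log 2 and log(1/2) <= -1/2. *)
Lemma ln_div_mono n : (4 <= n)%N ->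
  0 <= ln (n.+1%:R : R) / n.+1%:R <= ln (n%:R : R) / n%:R.
Proof.
move=> n4; have n0 : 0 < n%:R :> R by rewrite ltr0n; lia.
have lnn : 1 <= ln (n%:R : R).
  apply: (@le_trans _ _ (ln (4 : R))).
    have -> : (4 : R) = 2 * 2 by ring.
    rewrite lnM ?posrE //.
    have : ln (1 + - (1 / 2)) <= - (1 / 2) :> R by apply: le_ln1Dx; lra.
    have -> : 1 + - (1 / 2) = 2^-1 :> R by lra.
    rewrite lnV ?posrE //; lra.
  by rewrite ler_ln ?posrE // ler_nat.
have S : n.+1%:R = n%:R * (1 + n%:R^-1) :> R.
  by rewrite mulrDr mulr1 divff ?gt_eqF // natr1.
have l1 : ln (1 + n%:R^-1) <= n%:R^-1 :> R.
  by apply: le_ln1Dx; apply: lt_le_trans (_ : 0 <= _); rewrite ?ltrN10 ?invr_ge0 ?ltW.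
have lnS : ln (n.+1%:R : R) = ln n%:R + ln (1 + n%:R^-1).
  by rewrite S lnM ?posrE // addr_gt0 ?invr_gt0.
apply/andP; split; first by rewrite divr_ge0 // ln_ge0 // ler1n.
rewrite ler_pdivrMr ?ltr0n // mulrAC ler_pdivlMr // lnS -natr1.
have : ln (1 + n%:R^-1) * n%:R <= 1 :> R by rewrite -ler_pdivlMr // div1r.
lra.
Qed.

Lemma sum_ln_bounded F k : balanced F -> exists C, forall N,
  `|\sum_(1 <= n < N.+1) F (k * n)%N * (ln (n%:R : R) / n%:R)| <= C.
Proof.
move=> bF; have bFk := balanced_mul k bF.
have [M M0 FM] := periodic_bounded (let: And3 p _ _ := bFk in p).
pose a n := F (k * n)%N * (ln (n%:R : R) / n%:R).
exists (\sum_(1 <= n < 4) `|a n| + 2 * (m%:R * M) * (ln 4 / 4)) => N.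
have [N4|N4] := leqP N.+1 4.
  apply: le_trans (ler_norm_sum _ _ _) _.
  rewrite [X in _ <= X + _](big_cat_nat (n := N.+1)) //= -addrA lerDl.
  by rewrite addr_ge0 ?sumr_ge0 // !mulr_ge0 ?ln_ge0 ?invr_ge0 // ler1n.
rewrite (big_cat_nat (n := 4)) ?(ltnW N4) //=; apply: le_trans (ler_normD _ _) _.
apply: lerD; first exact: ler_norm_sum.
apply: (@abel_bound R (fun n => F (k * n)%N) (fun n => ln (n%:R : R) / n%:R)).
  exact: balanced_partial_sums bFk _ _.
by move=> n n4; apply: ln_div_mono.
Qed.

(** Expanding log n as a sum of Lambda(d) in [sum_ln_bounded] gives this sum with cutoff N/d in
    place of N. Changing the cutoff costs O(Lambda(d)/N) for each d, which is O(1) in total by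
    Chebyshev's bound. *)
Lemma mangoldt_Lsum_bounded F k : balanced F -> exists C, forall N,
  `|\sum_(1 <= d < N.+1) Lam d / d%:R * Lsum F (k * d) N| <= C.
Proof.
move=> bF; have [C HC] := sum_ln_bounded k bF; have [B B0 HB] := Lsum_tail bF.
have [A A0 HA] := psi_linear R.
exists (C + B * A) => N; have [->|N0] := posnP N.
  rewrite big_geq // normr0 addr_ge0 ?mulr_ge0 //.
  by apply: le_trans (HC 0%N).
have -> : \sum_(1 <= d < N.+1) Lam d / d%:R * Lsum F (k * d) N =
   \sum_(1 <= n < N.+1) F (k * n)%N * (ln (n%:R : R) / n%:R) +
   \sum_(1 <= d < N.+1) Lam d / d%:R * (Lsum F (k * d) N - Lsum F (k * d) (N %/ d)).
  have -> : \sum_(1 <= n < N.+1) F (k * n)%N * (ln (n%:R : R) / n%:R) =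
     \sum_(1 <= d < N.+1) Lam d / d%:R * Lsum F (k * d) (N %/ d).
    transitivity (\sum_(1 <= n < N.+1) \sum_(d <- divisors n)
        Lam d * (F (k * (d * (n %/ d)))%N / (d * (n %/ d))%:R)).
      apply: eq_big_nat => n /andP[n0 _].
      rewrite -sum_mangoldt // mulrCA big_distrl /=; apply: eq_big_seq => d.
      by rewrite -dvdn_divisors // => dn; rewrite [(d * _)%N]mulnC divnK.
    rewrite (dirichlet_exchange N (fun d e => Lam d * (F (k * (d * e))%N / (d * e)%:R))).
    apply: eq_bigr => d _; rewrite /Lsum big_distrr /=; apply: eq_bigr => e _.
    by rewrite mulnA natrM invfM; ring.
  by rewrite -big_split /=; apply: eq_bigr => d _; rewrite -mulrDr addrC subrK.
apply: le_trans (ler_normD _ _) _; apply: lerD => //.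
apply: le_trans (ler_norm_sum _ _ _) _.
apply: (@le_trans _ _ (\sum_(1 <= d < N.+1) B / N%:R * Lam d)).
  apply: ler_sum_nat => d /andP[d0 dN].
  rewrite normrM ger0_norm ?divr_ge0 ?mangoldt_ge0 //.
  rewrite mulrAC -mulrA mulrC ler_wpM2r ?mangoldt_ge0 //.
  apply: le_trans (div_floor_le B0 N0 d0).
  by rewrite ler_wpM2r ?invr_ge0 // HB // leq_div.
rewrite -big_distrr /= -mulrA ler_wpM2l // mulrC ler_pdivrMr ?ltr0n //.
exact: HA.
Qed.

Lemma le0_of_ln_bounded (a c : R) :
  (forall N, (0 < N)%N -> a * ln (N%:R : R) <= c) -> a <= 0.
Proof.
move=> H; rewrite leNgt; apply/negP => a0.
have [N HN] : exists N : nat, expR (`|c| / a + 1) < N%:R.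
  exists (Num.bound (expR (`|c| / a + 1))).
  by apply: archi_boundP; apply: expR_ge0.
have N0 : (0 < N)%N by rewrite -(ltr0n R); apply: lt_trans HN; apply: expR_gt0.
have := H N N0; rewrite leNgt => /negP; apply.
apply: le_lt_trans (ler_norm c) _; rewrite mulrC -ltr_pdivrMr //.
apply: (@lt_trans _ _ (`|c| / a + 1)); first by rewrite ltrDl.
by rewrite -[ltLHS]expRK ltr_ln ?posrE ?expR_gt0 // ltr0n.
Qed.

End PeriodicFunctions.

(** * Integer-valued balanced functions with vanishing L-sums *)

Section Independence.
Variables (R : realType) (m : nat).
Hypothesis m_gt0 : (0 < m)%N.
Variable F : nat -> R.
Hypothesis balF : balanced m F.
Hypothesis intF : forall n, exists z : int, F n = z%:~R.
Hypothesis LF : Lvanish F.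

Local Notation Lam := (mangoldt R).
Local Notation wt n := (Lam n / n%:R).

Let pF : periodic m F. Proof. by case: balF. Qed.
Let sF n : ~~ coprime n m -> F n = 0. Proof. by case: balF => _ H _; apply: H. Qed.

Let wt_ge0 n : 0 <= wt n.
Proof. by rewrite divr_ge0 ?mangoldt_ge0. Qed.

(** Quantifying over residues makes the predicates boolean; periodicity extends them to all
    arguments in [flipsP] and [fixesP]. *)
Let flips n := [forall i : 'I_m, F (n * i)%N == - F i].
Let fixes n := [forall i : 'I_m, F (n * i)%N == F i].
Let good n := coprime n m && flips n.
Let bad n := coprime n m && ~~ flips n.
Let stab n := coprime n m && (fixes n || flips n).

Let flipsP n : flips n -> forall x, F (n * x)%N = - F x.
Proof.
move=> /forallP H x; have /eqP := H (Ordinal (ltn_pmod x m_gt0)).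
by rewrite /= [F (x %% m)]periodic_modn // => <-; apply: periodic_congr => //; rewrite modnMmr.
Qed.

Let fixesP n : fixes n -> forall x, F (n * x)%N = F x.
Proof.
move=> /forallP H x; have /eqP := H (Ordinal (ltn_pmod x m_gt0)).
by rewrite /= [F (x %% m)]periodic_modn // => <-; apply: periodic_congr => //; rewrite modnMmr.
Qed.

(* For n prime to m, sum_i (F(ni) + F(i))^2 = 2 |F|^2 + 2 sum_i F(i) F(ni) is a
   nonnegative integer, and it is nonzero when n is bad. *)
Let bad_bounded : exists C, forall N, \sum_(1 <= n < N.+1 | bad n) wt n <= C.
Proof.
have [C C0 HC] := Lvanish_mangoldt LF; have [D D0 HD] := mertens_upper R.
pose N2 := \sum_(i < m) F i ^+ 2; have N20 : 0 <= N2 by apply: sumr_ge0 => i _; rewrite sqr_ge0.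
exists (2 * N2 * D + 2 * \sum_(i < m) `|F i| * C) => N.
have [->|N0] := posnP N.
  by rewrite big_geq // addr_ge0 ?mulr_ge0 // sumr_ge0 // => i _; rewrite mulr_ge0.
pose dist n := \sum_(i < m) (F (n * i)%N + F i) ^+ 2.
apply: (@le_trans _ _ (\sum_(1 <= n < N.+1 | coprime n m) wt n * dist n)).
  rewrite [leLHS]big_mkcond [leRHS]big_mkcond; apply: ler_sum_nat => n _.
  have dist0 : 0 <= dist n by apply: sumr_ge0 => i _; rewrite sqr_ge0.
  rewrite /bad; case: (coprime n m) => //=.
  case: ifP => [|_]; last by rewrite mulr_ge0.
  rewrite negb_forall => /existsP[i Hi].
  rewrite -[leLHS]mulr1 ler_wpM2l // /dist (bigD1 i) //=.
  apply: (@le_trans _ _ ((F (n * i)%N + F i) ^+ 2)); last first.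
    by rewrite lerDl sumr_ge0 // => j _; rewrite sqr_ge0.
  have [y Ey] := intF (n * i); have [z Ez] := intF i.
  move: Hi; rewrite Ey Ez -rmorphD /= -rmorphN /= eqr_int -subr_eq0 opprK => nz.
  rewrite -rmorphXn /= -[1]/(1%:~R) ler_int -gtz0_ge1 exprn_even_gt0 //.
have distE n : coprime n m -> dist n = 2 * N2 + 2 * \sum_(i < m) F i * F (n * i)%N.
  move=> nm; rewrite /dist.
  rewrite (eq_bigr (fun i : 'I_m => F (n * i)%N ^+ 2 + 2 * (F i * F (n * i)%N) + F i ^+ 2));
    last by move=> i _; ring.
  rewrite !big_split /= (sum_mul_coprime m_gt0 (F := fun n => F n ^+ 2)) //; last first.
    by move=> x; rewrite pF.
  by rewrite -/N2 -big_distrr /=; ring.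
have -> : \sum_(1 <= n < N.+1 | coprime n m) wt n * dist n =
    2 * N2 * \sum_(1 <= n < N.+1 | coprime n m) wt n +
    2 * \sum_(i < m) F i * \sum_(1 <= n < N.+1) F (i * n)%N * wt n.
  under [X in _ = _ + 2 * X]eq_bigr do rewrite big_distrr /=.
  rewrite exchange_big /= [X in _ = X + _]big_distrr [X in _ = _ + X]big_distrr /=.
  rewrite [LHS]big_mkcond [X in _ = X + _]big_mkcond -big_split /=.
  apply: eq_bigr => n _; case: ifP => [nm|/negbT nm].
    rewrite distE // mulrDr [X in X + _ = _]mulrC; congr (_ + _).
    rewrite mulrCA; congr (_ * _); rewrite big_distrr /=.
    by apply: eq_bigr => i _; rewrite [(i * n)%N]mulnC; ring.
  rewrite big1 ?mulr0 ?addr0 // => i _.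
  have -> : F (i * n)%N = 0 by apply: sF; rewrite coprimeMl (negPf nm) andbF.
  by rewrite mul0r mulr0.
(* The main terms of the next two bounds, 2 [N2] log N and -2 [N2] log N, cancel. *)
have wN : \sum_(1 <= n < N.+1 | coprime n m) wt n <= ln N%:R + D.
  apply: le_trans (HD N N0); rewrite big_mkcond; apply: ler_sum_nat => n _.
  by case: ifP.
have FN : \sum_(i < m) F i * \sum_(1 <= n < N.+1) F (i * n)%N * wt n <=
     \sum_(i < m) `|F i| * C - N2 * ln N%:R.
  rewrite /N2 big_distrl /= -sumrB; apply: ler_sum => i _.
  have := HC i N N0; set S := \sum_(_ <= _ < _) _ => HS.
  have -> : F i * S = F i * (F i * ln N%:R + S) - F i ^+ 2 * ln N%:R by ring.
  rewrite lerD2r; apply: le_trans (ler_norm _) _; rewrite normrM.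
  by rewrite ler_wpM2l.
have := ler_wpM2l N20 wN; lra.
Qed.

Let wt_split (G : nat -> R) N : (forall n, ~~ coprime n m -> G n = 0) ->
  \sum_(1 <= n < N.+1) G n * wt n =
  \sum_(1 <= n < N.+1 | good n) G n * wt n + \sum_(1 <= n < N.+1 | bad n) G n * wt n.
Proof.
move=> G0; rewrite [X in _ = X + _]big_mkcond [X in _ = _ + X]big_mkcond -big_split /=.
apply: eq_bigr => n _; rewrite /good /bad.
have [cn|/G0 ->] := boolP (coprime n m); last by rewrite mul0r addr0.
by case: (flips n); rewrite /= ?addr0 ?add0r.
Qed.

Let bad_weighted (G : nat -> R) N M C :
    (forall n, `|G n| <= M) -> \sum_(1 <= n < N.+1 | bad n) wt n <= C ->
  `|\sum_(1 <= n < N.+1 | bad n) G n * wt n| <= M * C.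
Proof.
move=> GM HC; have M0 : 0 <= M by apply: le_trans (GM 0%N).
apply: le_trans (ler_norm_sum _ _ _) _.
apply: le_trans (ler_wpM2l M0 HC); rewrite big_distrr /=; apply: ler_sum => n _.
by rewrite normrM [`|wt n|]ger0_norm // ler_wpM2r.
Qed.

Variable k0 : nat.
Hypothesis Fk0 : F k0 != 0.

(** At [k0] the good n contribute -F(k0) times their weight and the bad ones O(1), so
    [Lvanish_mangoldt] bounds F(k0) times log N minus the good weight. *)
Let good_large : exists C, forall N, (0 < N)%N ->
  ln (N%:R : R) <= \sum_(1 <= n < N.+1 | good n) wt n + C.
Proof.
have [C C0 HC] := Lvanish_mangoldt LF; have [D HD] := bad_bounded.
have [M M0 FM] := periodic_bounded m_gt0 pF.
exists ((C + M * D) / `|F k0|) => N N0.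
have F0 : 0 < `|F k0| by rewrite normr_gt0.
rewrite -lerBlDl ler_pdivlMr // mulrC.
apply: le_trans (ler_wpM2l (ltW F0) (ler_norm _)) _; rewrite -normrM.
have := HC k0 N N0; rewrite wt_split; last first.
  by move=> n nm; rewrite sF // coprimeMl (negPf nm) andbF.
have -> : \sum_(1 <= n < N.+1 | good n) F (k0 * n)%N * wt n =
          - F k0 * \sum_(1 <= n < N.+1 | good n) wt n.
  rewrite big_distrr /=; apply: eq_bigr => n /andP[_ fn].
  by rewrite [(k0 * n)%N]mulnC flipsP.
have := bad_weighted (G := fun n => F (k0 * n)%N) (fun n => FM _) (HD N).
set S := \sum_(_ <= _ < _ | good _) _; set T := \sum_(_ <= _ < _ | bad _) _.
set l := ln _ => HT HS.
have -> : F k0 * (l - S) = (F k0 * l + (- F k0 * S + T)) - T by ring.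
by apply: le_trans (ler_normB _ _) _; apply: lerD.
Qed.

(** Bad classes contribute O(1), and good ones do not change E, so both Mangoldt estimates reduce to
    a single value times a weight growing like log N. *)
Let invariant_eq0 (E : nat -> R) : balanced m E ->
    (forall d x, good d -> E (x * d)%N = E x) -> forall x, E x = 0.
Proof.
move=> balE invE; have [D HD] := bad_bounded; have [C1 HC1] := good_large.
have [M M0 EM] := periodic_bounded m_gt0 (let: And3 p _ _ := balE in p).
have sE n : ~~ coprime n m -> E n = 0 by case: balE => _ H _; apply: H.
have [B B0 HB] := Lsum_tail m_gt0 balE.
have Ebd k N : `|Lsum E k N| <= B.
  have := HB k 0%N N (leq0n _); rewrite divr1.
  by rewrite [Lsum E k 0]/Lsum big_geq // subr0.
(* For good d, [Lsum E (k * d)] equals [Lsum E k]. By [mangoldt_Lsum_bounded] its product with the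
   good weight is bounded, so the limit is 0. *)
have LE : Lvanish E.
  exists B => // k N; have [C HC] := mangoldt_Lsum_bounded m_gt0 k balE.
  rewrite -subr_le0; apply: (@le0_of_ln_bounded R _ (`|C| + B * `|D| + B * `|C1|)) => N1 N10.
  set x := `|Lsum E k N| - _.
  have [x0|x0] := leP x 0.
    apply: (@le_trans _ _ 0).
      by rewrite mulr_le0_ge0 // ln_ge0 // ler1n.
    by rewrite !addr_ge0 ?mulr_ge0.
  (* The term subtracted in [x] absorbs the change of the L-sum between N and N2. *)
  pose N2 := maxn N N1.
  have N20 : (0 < N2)%N by rewrite leq_max N10 orbT.
  apply: (@le_trans _ _ (`|Lsum E k N2| * ln N2%:R)).
    apply: ler_pM; rewrite ?(ltW x0) ?ln_ge0 ?ler1n //; last first.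
      by rewrite ler_ln ?posrE ?ltr0n // ler_nat leq_maxr.
    have := HB k N N2 (leq_maxl _ _); rewrite /x distrC.
    have := ler_normD (Lsum E k N - Lsum E k N2) (Lsum E k N2).
    rewrite subrK; move: (B / _) => e; lra.
  apply: le_trans (ler_wpM2l (normr_ge0 _) (HC1 N2 N20)) _.
  rewrite mulrDr; apply: lerD; last first.
    apply: (@le_trans _ _ (`|Lsum E k N2| * `|C1|)).
      by rewrite ler_wpM2l ?ler_norm.
    by rewrite ler_wpM2r.
  set G := \sum_(_ <= _ < _ | _) _.
  have G0 : 0 <= G by rewrite sumr_ge0.
  rewrite -[G]ger0_norm // -normrM.
  have := HC N2; under eq_bigr do rewrite mulrC.
  rewrite (wt_split (G := fun d => Lsum E (k * d) N2)); last first.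
    move=> d dm; rewrite /Lsum big1 // => n _.
    by rewrite sE ?mul0r // !coprimeMl (negPf dm) andbF.
  have -> : \sum_(1 <= d < N2.+1 | good d) Lsum E (k * d) N2 * wt d = Lsum E k N2 * G.
    rewrite big_distrr /=; apply: eq_bigr => d gd; congr (_ * _).
    by apply: eq_bigr => n _; rewrite mulnAC invE.
  have := bad_weighted (G := fun d => Lsum E (k * d) N2) (fun d => Ebd _ _)
            (le_trans (HD N2) (ler_norm D)).
  set S := Lsum _ _ _ * G; set T := \sum_(_ <= _ < _ | _) _ => HT HS.
  have -> : S = (S + T) - T by ring.
  apply: le_trans (ler_normB _ _) _; apply: lerD => //.
  exact: le_trans HS (ler_norm _).
(* Now E(x) times log N plus the good weight is bounded; both summands are nonnegative, so E(x) =
   0. *)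
move=> x; have [C C0 HC] := Lvanish_mangoldt LE.
apply/eqP; rewrite -normr_le0; apply: (@le0_of_ln_bounded R _ (C + M * D)) => N N0.
have := HC x N N0; rewrite wt_split; last first.
  by move=> d dm; rewrite sE // coprimeMl (negPf dm) andbF.
have -> : \sum_(1 <= d < N.+1 | good d) E (x * d)%N * wt d =
    E x * \sum_(1 <= d < N.+1 | good d) wt d.
  by rewrite big_distrr /=; apply: eq_bigr => d gd; rewrite invE.
have := bad_weighted (G := fun d => E (x * d)%N) (fun d => EM _) (HD N).
set G := \sum_(_ <= _ < _ | good _) _; set T := \sum_(_ <= _ < _ | bad _) _ => HT HS.
have G0 : 0 <= G by rewrite sumr_ge0.
have l0 : 0 <= ln (N%:R : R) by rewrite ln_ge0 // ler1n.
apply: (@le_trans _ _ `|E x * (ln N%:R + G)|).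
  by rewrite normrM ler_wpM2l // [leRHS]ger0_norm ?addr_ge0 // lerDl.
have -> : E x * (ln N%:R + G) = (E x * ln N%:R + (E x * G + T)) - T by ring.
by apply: le_trans (ler_normB _ _) _; apply: lerD.
Qed.

Let stab_mul k n : stab k -> stab (k * n) = stab n.
Proof.
case/andP=> km sk; rewrite /stab coprimeMl km /=; congr (_ && _).
have E x : F (k * n * x)%N = F (n * x)%N \/ F (k * n * x)%N = - F (n * x)%N.
  by case/orP: sk => [/fixesP H|/flipsP H]; rewrite -mulnA H; [left|right].
case/orP: sk => [/fixesP H|/flipsP H].
  by congr (_ || _); apply: eq_forallb => i; rewrite -mulnA H.
rewrite orbC; congr (_ || _); apply: eq_forallb => i; rewrite -mulnA H.
  by rewrite eqr_opp.
by rewrite eqr_oppLR.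
Qed.

Let stab_periodic n : stab (n + m) = stab n.
Proof.
rewrite /stab /fixes /flips.
have -> : coprime (n + m) m = coprime n m by rewrite /coprime gcdnC gcdnDr gcdnC.
have E (i : 'I_m) : F ((n + m) * i)%N = F (n * i)%N.
  by apply: (periodic_congr pF); rewrite mulnDl addnC mulnC modnMDl.
by congr (_ && (_ || _)); apply: eq_forallb => i; rewrite E.
Qed.

(** Apply [invariant_eq0] to the indicator of the stabilizer minus its translate by u. Good classes
    lie in the stabilizer, so the difference is invariant; its value at 1 is 0 only if u is in the
    stabilizer. *)
Let stab_coprime u : coprime u m -> stab u.
Proof.
move=> um; pose E n : R := (stab n)%:R - (stab (u * n))%:R.
have balS : periodic m (fun n => (stab n)%:R : R).
  by move=> n; rewrite stab_periodic.
have balE : balanced m E.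
  split.
  - by move=> n; rewrite /E stab_periodic (periodic_mul u balS).
  - by move=> n nm; rewrite /E /stab coprimeMl (negPf nm) andbF subrr.
  - by rewrite /E sumrB (sum_mul_coprime m_gt0 balS um) subrr.
have invE d x : good d -> E (x * d)%N = E x.
  case/andP=> dm fd; have sd : stab d by rewrite /stab dm fd orbT.
  by rewrite /E [(x * d)%N]mulnC mulnCA !(stab_mul _ sd).
have s1 : stab 1.
  by rewrite /stab coprime1n; apply/orP; left; apply/forallP => i; rewrite mul1n.
have := invariant_eq0 balE invE 1; rewrite /E muln1 s1.
by case: (stab u) => // /eqP; rewrite subr0 oner_eq0.
Qed.

(* By [stab_coprime], F / F(1) is a real character modulo m. *)
Lemma Lvanish_contradiction : False.
Proof.
have Fsgn n x : coprime n m -> F (n * x)%N = F x \/ F (n * x)%N = - F x.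
  move/stab_coprime/andP=> [_ /orP[/fixesP H|/flipsP H]]; by [left|right].
have F1 : F 1 != 0.
  have km : coprime k0 m by apply: contraNT Fk0 => /sF ->.
  have := Fsgn k0 1%N km; have := Fk0; rewrite muln1 => Fk.
  by case=> E; move: Fk; rewrite E ?oppr_eq0.
pose chi n := F n / F 1.
have chi1 : chi 1 = 1 by rewrite /chi divff.
have chi_val n : [\/ chi n = 0, chi n = 1 | chi n = -1].
  have [nm|/sF nm] := boolP (coprime n m); last by constructor 1; rewrite /chi nm mul0r.
  have := Fsgn n 1%N nm; rewrite muln1 /chi => -[->|->].
    by constructor 2; rewrite divff.
  by constructor 3; rewrite mulNr divff.
have chiM a b : chi (a * b)%N = chi a * chi b.
  have [am|am] := boolP (coprime a m); last first.
    by rewrite /chi (sF am) sF ?mul0r // coprimeMl (negPf am).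
  move: am => /stab_coprime/andP[_ /orP[/fixesP H|/flipsP H]]; rewrite /chi -{2}[a]muln1 !H;
  by field.
have [M M0 FM] := periodic_bounded m_gt0 pF; have [B B0 HB] := LF.
apply: (@real_character_nonvanishing R chi (2 * (m%:R * M) / `|F 1|) (B / `|F 1|)) => //.
- move=> N; rewrite /chi -big_distrl /= normrM normfV ler_wpM2r ?invr_ge0 //.
  exact: balanced_partial_sums.
- move=> N; have := HB 1%N N; rewrite /Lsum => H.
  have -> : \sum_(1 <= n < N.+1) chi n / n%:R =
      (\sum_(1 <= n < N.+1) F (1 * n)%N / n%:R) / F 1.
    by rewrite big_distrl /=; apply: eq_bigr => n _; rewrite mul1n /chi mulrAC.
  by rewrite normrM normfV mulrAC ler_wpM2r ?invr_ge0.
Qed.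

End Independence.

Lemma Lvanish_eq0 (R : realType) m (F : nat -> R) : (0 < m)%N -> balanced m F ->
  (forall n, exists z : int, F n = z%:~R) -> Lvanish F -> forall n, F n = 0.
Proof.
move=> m0 balF intF LF n; apply/eqP/negPn/negP => Fn.
exact: (Lvanish_contradiction m0 balF intF LF Fn).
Qed.

(** * Logarithms on the unit circle *)

Section LogSeries.
Variables (R : realType) (c : nat -> R).
Hypothesis c0 : c 0 = 1.
Hypothesis cS : forall n, c n.+2 = 2 * c 1 * c n.+1 - c n.
Hypothesis c_le1 : forall n, `|c n| <= 1.

Let q x : R := x ^+ 2 - 2 * c 1 * x + 1.

Let q_ge x : 0 <= x -> (1 - x) ^+ 2 <= q x.
Proof.
by move=> x0; have := c_le1 1; rewrite ler_norml /q => /andP[_ H]; nra.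
Qed.

(** Truncated form of Re(w/(1 - xw)) = (c 1 - x)/|1 - xw|^2, by the recurrence. *)
Let geom N x : q x * (\sum_(i < N) c i.+1 * x ^+ i) =
  c 1 - x - x ^+ N * c N.+1 + x ^+ N.+1 * c N.
Proof.
elim: N => [|N IH]; first by rewrite big_ord0 c0 /q; ring.
by rewrite big_ord_recr /= mulrDr IH cS /q !exprS; ring.
Qed.

Let P N : {poly R} := \poly_(i < N.+1) (c i / i%:R).
Let Q : {poly R} := 'X^2 - (2 * c 1) *: 'X + 1.

Let PE N x : (P N).[x] = \sum_(1 <= n < N.+1) x ^+ n * c n / n%:R.
Proof.
rewrite horner_poly -(big_mkord xpredT (fun i => c i / i%:R * x ^+ i)) big_ltn //=.
rewrite invr0 mulr0 mul0r add0r; apply: eq_bigr => i _; ring.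
Qed.

Let dPE N x : (P N)^`().[x] = \sum_(i < N) c i.+1 * x ^+ i.
Proof.
rewrite (_ : (P N)^`() = \poly_(i < N) c i.+1) ?horner_poly //.
apply/polyP => i; rewrite coef_deriv !coef_poly ltnS; case: ifP => _; last by rewrite mul0rn.
by rewrite -[LHS]mulr_natr divfK // pnatr_eq0.
Qed.

Let QE x : Q.[x] = q x.
Proof. by rewrite /Q /q !hornerE. Qed.

Let dQE x : Q^`().[x] = 2 * (x - c 1).
Proof. by rewrite /Q !poly.derivE !hornerE; ring. Qed.

(* The hypotheses on c characterize c n = Re(w^n) with |w| = 1, for which
   r^2 - 2 (c 1) r + 1 = |1 - r w|^2. *)
Lemma log_series N r : 0 <= r < 1 ->
  `|ln (r ^+ 2 - 2 * c 1 * r + 1) / 2 + \sum_(1 <= n < N.+1) r ^+ n * c n / n%:R|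
    <= 2 * r ^+ N / (1 - r) ^+ 2.
Proof.
case/andP=> r0 r1.
have q_gt0 x : 0 <= x -> x <= r -> 0 < q x.
  move=> x0 xr; apply: lt_le_trans (q_ge x0); rewrite exprn_gt0 // subr_gt0.
  exact: le_lt_trans r1.
(* The quantity to bound, as a function of r. It vanishes at 0, and by [geom] its derivative is a
   remainder of order x^N over [q x], so the mean value theorem applies. *)
pose phi x := 2^-1 * ln Q.[x] + (P N).[x].
pose dphi x := 2^-1 * (Q.[x]^-1 * Q^`().[x]) + (P N)^`().[x].
have dphiP (x : R) : 0 <= x -> x <= r -> is_derive x 1 phi (dphi x).
  move=> x0 xr; have dln : is_derive Q.[x] 1 (@ln R) Q.[x]^-1.
    by apply: is_derive1_ln; rewrite QE q_gt0.
  have dlnQ : is_derive x 1 (@ln R \o horner Q) (Q.[x]^-1 * Q^`().[x]).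
    exact: is_derive1_comp.
  exact: (@is_deriveD _ _ _ (2^-1 \*: (@ln R \o horner Q)) (horner (P N))).
have [||y] := @MVT_segment R phi dphi 0 r r0.
- by move=> x /itvP x0r; apply: dphiP; rewrite ?x0r // ltW ?x0r.
- apply: derivable_within_continuous => x /itvP x0r.
  by apply: ex_derive; apply: dphiP; rewrite x0r.
move=> /itvP y0r; have y0 : 0 <= y by rewrite y0r.
have yr : y <= r by rewrite y0r.
have phi0 : phi 0 = 0.
  rewrite /phi QE PE /q expr0n mulr0 subr0 add0r ln1 mulr0 add0r big_nat_cond big1 // => n.
  by move=> /andP[/andP[n0 _] _]; rewrite expr0n gtn_eqF // !mul0r.
rewrite phi0 !subr0 => E.
have -> : ln (r ^+ 2 - 2 * c 1 * r + 1) / 2 +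
   \sum_(1 <= n < N.+1) r ^+ n * c n / n%:R = phi r.
  by rewrite /phi QE PE mulrC.
rewrite E; have qy := q_gt0 y y0 yr.
have -> : dphi y = (y ^+ N.+1 * c N - y ^+ N * c N.+1) / q y.
  rewrite /dphi QE dQE dPE; apply: (mulfI (lt0r_neq0 qy)).
  rewrite mulrDr geom mulrCA [in RHS]mulrC divfK ?lt0r_neq0 //.
  by rewrite [q y * _]mulrA divff ?lt0r_neq0 //; field.
have y1 : 0 < (1 - y) ^+ 2 by rewrite exprn_gt0 // subr_gt0; apply: le_lt_trans r1.
have r1' : 0 < (1 - r) ^+ 2 by rewrite exprn_gt0 // subr_gt0.
rewrite normrM [`|r|]ger0_norm // -[leRHS]mulr1 ler_pM ?(ltW r1) //.
rewrite normrM normfV [`|q y|]gtr0_norm // ler_pM // ?invr_ge0 ?(ltW qy) //.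
  have yN : y ^+ N.+1 <= r ^+ N.
    rewrite exprS -[leRHS]mul1r ler_pM ?exprn_ge0 //; first exact: le_trans (ltW r1).
    by rewrite lerXn2r ?nnegrE.
  have yN' : y ^+ N <= r ^+ N by rewrite lerXn2r ?nnegrE.
  apply: le_trans (ler_normB _ _) _; rewrite !normrM ![`|y ^+ _|]ger0_norm ?exprn_ge0 //.
  have -> : 2 * r ^+ N = r ^+ N * 1 + r ^+ N * 1 by ring.
  by apply: lerD; apply: ler_pM; rewrite ?exprn_ge0.
rewrite lef_pV2 ?posrE //; apply: le_trans (q_ge y0).
by rewrite ler_sqr ?nnegrE ?subr_ge0 ?(ltW r1) ?(le_trans yr (ltW r1)) // lerD2l lerN2.
Qed.

End LogSeries.

(** * Fourier inversion over the m-th roots of unity and Abel limits *)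

Section UnitCircle.
Variables (R : realType) (m : nat) (z : R[i]).
Hypothesis m_gt1 : (1 < m)%N.
Hypothesis z_prim : m.-primitive_root z.

Let m_gt0 : (0 < m)%N. Proof. exact: ltnW. Qed.

Definition cz j : R := complex.Re (z ^+ j).

Lemma circle_Re_Im j : cz j ^+ 2 + complex.Im (z ^+ j) ^+ 2 = 1.
Proof.
apply: complexI; rewrite add_Re2_Im2 rmorph1 normrX.
suff -> : `|z| = 1 by rewrite !expr1n.
apply/eqP; rewrite -(pexpr_eq1 m_gt0) // -normrX (prim_expr_order z_prim).
by rewrite normr1.
Qed.

Lemma cz0 : cz 0 = 1. Proof. by []. Qed.

Lemma cz_le1 j : `|cz j| <= 1.
Proof.
rewrite -(ler_pXn2r (n := 2)) ?nnegrE // expr1n real_normK ?num_real //.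
by rewrite -(circle_Re_Im j) lerDl sqr_ge0.
Qed.

Lemma cz_eq1 j : (cz j == 1) = (m %| j)%N.
Proof.
rewrite (prim_order_dvd z_prim) eq_complex /= -/(cz j).
case: eqP => //= c1; have := circle_Re_Im j; rewrite c1 expr1n.
by move/(canRL (addKr _))/eqP; rewrite addNr sqrf_eq0 => ->.
Qed.

Lemma czS j n : cz (j * n.+2) = 2 * cz (j * 1) * cz (j * n.+1) - cz (j * n).
Proof.
rewrite /cz muln1 !mulnS !exprD; have := circle_Re_Im j; rewrite /cz.
case: (z ^+ (j * n)) (z ^+ j) => [x y] [a b] /= H.
have E : x = (a ^+ 2 + b ^+ 2) * x by rewrite H mul1r.
rewrite [X in _ = _ - X]E; ring.
Qed.

(** The product formula for cosines. The factor m - 1 stands for -1: z^(a(m-1)) is the conjugate of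
    z^a. *)
Lemma cz_mul a b : 2 * cz a * cz b = cz (b + a) + cz (b + a * m.-1).
Proof.
have E : z ^+ (a * m.-1) = (z ^+ a)^*%C.
  have z0 : z != 0.
    by have := oner_neq0 R[i]; rewrite -(prim_expr_order z_prim) expf_eq0 m_gt0.
  apply: (@mulfI _ (z ^+ a)); first by rewrite expf_neq0.
  rewrite -exprD -mulnS prednK // mulnC exprM (prim_expr_order z_prim) expr1n.
  rewrite -sqr_normc -add_Re2_Im2 -/(cz a) circle_Re_Im //.
rewrite /cz !exprD E; case: (z ^+ a) (z ^+ b) => [x y] [x' y'] /=; ring.
Qed.

Lemma sum_cz j : \sum_(a < m) cz (a * j) = m%:R * (m %| j)%:R.
Proof.
have [mj|mj] := boolP (m %| j)%N.
  rewrite mulr1 (eq_bigr (fun=> 1)) ?sumr_const ?card_ord // => a _.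
  by apply/eqP; rewrite cz_eq1 dvdn_mull.
rewrite mulr0 /cz.
have -> : \sum_(a < m) complex.Re (z ^+ (a * j)) = complex.Re (\sum_(a < m) z ^+ (a * j)).
  by apply/esym/(big_morph (@complex.Re R)) => // -[? ?] [? ?].
suff -> : \sum_(a < m) z ^+ (a * j) = 0 by [].
have zj : z ^+ j - 1 != 0 by rewrite subr_eq0 -(prim_order_dvd z_prim).
apply: (mulfI zj); rewrite mulr0.
under eq_bigr do rewrite mulnC exprM.
by rewrite -subrX1 -exprM mulnC exprM (prim_expr_order z_prim) expr1n subrr.
Qed.

Lemma cz_orthogonality j :
  \sum_(a < m) 2 * cz a * cz (a * j) =
  m%:R * ((m %| j + 1)%:R + (m %| j + m.-1)%:R).
Proof.
under eq_bigr do rewrite cz_mul -{2}[nat_of_ord _]muln1 -!mulnDr.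
by rewrite big_split /= !sum_cz mulrDr.
Qed.

Lemma log_series_cz j N r : 0 <= r < 1 ->
  `|ln (r ^+ 2 - 2 * cz j * r + 1) / 2 +
    \sum_(1 <= n < N.+1) r ^+ n * cz (j * n) / n%:R| <= 2 * r ^+ N / (1 - r) ^+ 2.
Proof.
move=> r01; have := @log_series R (fun n => cz (j * n)) (congr1 cz (muln0 j)) (czS j)
  (fun n => cz_le1 (j * n)) N r r01.
by rewrite muln1.
Qed.

(** Used with A = |1 - w|^2 for |w| = 1, when r A + (1 - r)^2 = |1 - r w|^2. *)
Lemma ln_near_circle (A r : R) : 0 < A -> 1 / 2 <= r < 1 ->
  `|ln (r * A + (1 - r) ^+ 2) - ln A| <= (1 - r) * (2 + A^-1).
Proof.
move=> A0 /andP[r2 r1]; have r0 : 0 < r by apply: lt_le_trans r2; lra.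
have iA : 0 < A^-1 by rewrite invr_gt0.
have B0 : 0 < r + (1 - r) ^+ 2 / A.
  by rewrite ltr_wpDr // divr_ge0 ?sqr_ge0 ?ltW.
have -> : r * A + (1 - r) ^+ 2 = A * (r + (1 - r) ^+ 2 / A).
  by rewrite mulrDr mulrCA divff ?gt_eqF // mulr1 mulrC.
rewrite lnM ?posrE // addrAC subrr add0r.
rewrite ler_norml; apply/andP; split.
  apply: (@le_trans _ _ (ln r)); last first.
    by rewrite ler_ln ?posrE // lerDl divr_ge0 ?sqr_ge0 ?ltW.
  have : ln (1 + (r^-1 - 1)) <= r^-1 - 1 by apply: le_ln1Dx; rewrite ltrBrDl subrr invr_gt0.
  rewrite addrC subrK lnV ?posrE // => H.
  have : r^-1 - 1 <= (1 - r) * 2.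
    rewrite -(ler_pM2l r0) mulrBr divff ?gt_eqF //; nra.
  nra.
have -> : r + (1 - r) ^+ 2 / A = 1 + ((1 - r) ^+ 2 / A - (1 - r)) by ring.
apply: (@le_trans _ _ ((1 - r) ^+ 2 / A - (1 - r))).
  apply: le_ln1Dx; apply: (@lt_le_trans _ _ (- (1 - r))); first lra.
  by rewrite lerDr divr_ge0 ?sqr_ge0 ?ltW.
have e0 : 0 <= 1 - r by rewrite subr_ge0 ltW.
have : 0 <= (1 - r) * A^-1 * r by rewrite !mulr_ge0 ?(ltW r0) ?(ltW iA).
move: (A^-1) => i; nra.
Qed.

Variables (T : finType) (v : T -> nat) (D : T -> R).
Hypothesis v_coprime : forall h, coprime (v h) m.
Hypothesis sumD : \sum_h D h = 0.

(* As m.-1 stands for -1, this is D at the h with v h * n = 1 modulo m, if any. *)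
Definition inv_fun n : R := \sum_h D h * (m %| v h * n + m.-1)%:R.

(** The form in which evenness enters: it merges the two congruences of [cz_orthogonality]. *)
Hypothesis evenD : forall n, \sum_h D h * (m %| v h * n + 1)%:R = inv_fun n.
(** Since 2 - 2 [cz j] = |1 - z^j|^2, this is a multiplicative relation after taking logarithms of
    absolute values. *)
Hypothesis logD : forall a, ~~ (m %| a)%N ->
  \sum_h D h * ln (2 - 2 * cz (v h * a)) = 0.

Lemma inv_fun_balanced : balanced m inv_fun.
Proof.
split.
- move=> n; apply: eq_bigr => h _; rewrite mulnDr -addnA [(v h * m + _)%N]addnC addnA.
  by rewrite dvdn_addl ?dvdn_mull.
- move=> n nm; rewrite /inv_fun big1 // => h _.
  case: (boolP (m %| v h * n + m.-1)%N) => H; last by rewrite mulr0.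
  case/negP: nm; rewrite /coprime -dvdn1.
  have g1 : (gcdn n m %| v h * n + m.-1)%N by apply: dvdn_trans H; apply: dvdn_gcdr.
  have g2 : (gcdn n m %| m.-1)%N by rewrite -(dvdn_addr _ (dvdn_mull (v h) (dvdn_gcdl n m))).
  by rewrite -(dvdn_addr _ g2) addn1 prednK // dvdn_gcdr.
- rewrite /inv_fun exchange_big /=.
  pose delta n : R := (m %| n + m.-1)%:R.
  have pdelta : periodic m delta.
    by move=> n; rewrite /delta addnAC dvdn_addl.
  rewrite (eq_bigr (fun h => D h * \sum_(i < m) delta i)).
    by rewrite -big_distrl /= sumD mul0r.
  move=> h _; rewrite -big_distrr /=; congr (_ * _).
  exact: (sum_mul_coprime m_gt0 pdelta (v_coprime h)).
Qed.

Variable k : nat.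
Hypothesis k_coprime : coprime k m.

(** [Lr] is the L-sum with Abel factors r^n, [lg r a h] is log|1 - r z^(a (v h) k)|, and [W] is the
    Fourier combination to which -m [Lr] tends as N -> oo. *)
Let Lr r N := \sum_(1 <= n < N.+1) r ^+ n * inv_fun (k * n) / n%:R.
Let lg r a h := ln (r ^+ 2 - 2 * cz (a * (v h * k)) * r + 1) / 2.
Let W r := \sum_(a < m) cz a * \sum_h D h * lg r a h.

Let inv_fun_cz n : m%:R * inv_fun (k * n) =
  \sum_(a < m) cz a * \sum_h D h * cz (a * (v h * k) * n).
Proof.
apply: (@mulfI R 2); first by rewrite pnatr_eq0.
transitivity (\sum_h D h * (m%:R * ((m %| v h * (k * n) + 1)%:R + (m %| v h * (k * n) + m.-1)%:R))).
  have -> : 2 * (m%:R * inv_fun (k * n)) = m%:R * (inv_fun (k * n) + inv_fun (k * n)) by ring.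
  rewrite -{1}evenD /inv_fun -big_split big_distrr /=; apply: eq_bigr => h _; ring.
under eq_bigr do rewrite -cz_orthogonality big_distrr /=.
rewrite exchange_big big_distrr /=; apply: eq_bigr => a _.
rewrite !big_distrr /=; apply: eq_bigr => h _.
have -> : (a * (v h * (k * n)) = a * (v h * k) * n)%N by rewrite !mulnA.
ring.
Qed.

Let Lr_W_bound : exists C, forall r N, 0 <= r < 1 ->
  `|m%:R * Lr r N + W r| <= C * (2 * r ^+ N / (1 - r) ^+ 2).
Proof.
exists (\sum_(a < m) \sum_h `|D h|) => r N r01.
have -> : m%:R * Lr r N + W r = \sum_(a < m) cz a * \sum_h D h *
   (lg r a h + \sum_(1 <= n < N.+1) r ^+ n * cz (a * (v h * k) * n) / n%:R).
  have -> : m%:R * Lr r N = \sum_(a < m) cz a * \sum_h D h *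
      \sum_(1 <= n < N.+1) r ^+ n * cz (a * (v h * k) * n) / n%:R.
    rewrite /Lr big_distrr /=.
    transitivity (\sum_(1 <= n < N.+1) \sum_(a < m)
       cz a * \sum_h D h * (r ^+ n * cz (a * (v h * k) * n) / n%:R)).
      apply: eq_bigr => n _.
      have -> : m%:R * (r ^+ n * inv_fun (k * n) / n%:R) =
                (r ^+ n / n%:R) * (m%:R * inv_fun (k * n)) by ring.
      rewrite inv_fun_cz big_distrr /=; apply: eq_bigr => a _.
      rewrite mulrCA; congr (_ * _); rewrite big_distrr /=; apply: eq_bigr => h _; ring.
    rewrite exchange_big /=; apply: eq_bigr => a _; rewrite -big_distrr /=; congr (_ * _).
    by rewrite exchange_big /=; apply: eq_bigr => h _; rewrite -big_distrr.
  rewrite /W -big_split /=; apply: eq_bigr => a _; rewrite -mulrDr -big_split /=.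
  by congr (_ * _); apply: eq_bigr => h _; rewrite -mulrDr addrC.
apply: le_trans (ler_norm_sum _ _ _) _; rewrite big_distrl /=; apply: ler_sum => a _.
rewrite normrM -[leRHS]mul1r ler_pM ?cz_le1 //.
apply: le_trans (ler_norm_sum _ _ _) _; rewrite big_distrl /=; apply: ler_sum => h _.
by rewrite normrM ler_wpM2l // log_series_cz.
Qed.

(** For a <> 0 the logarithms differ by O(1 - r) from their values at r = 1, whose combination
    vanishes by [logD]. *)
Let W_small : exists2 C, 0 <= C & forall r, 1 / 2 <= r < 1 -> `|W r| <= (1 - r) * C.
Proof.
pose A (a : nat) h := 2 - 2 * cz (a * (v h * k)).
have A0 a h : 0 <= A a h by have := cz_le1 (a * (v h * k)); rewrite ler_norml /A; lra.
exists (\sum_(a < m) \sum_h `|D h| * (2 + (A a h)^-1)).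
  by apply: sumr_ge0 => a _; apply: sumr_ge0 => h _; rewrite mulr_ge0 // addr_ge0 ?invr_ge0.
move=> r rr; have r1 : 0 <= 1 - r by move: rr; lra.
rewrite /W big_distrr /=; apply: le_trans (ler_norm_sum _ _ _) _; apply: ler_sum => a _.
rewrite normrM -[leRHS]mul1r ler_pM ?cz_le1 //.
have rhs0 : 0 <= \sum_h `|D h| * (2 + (A a h)^-1).
  by apply: sumr_ge0 => h _; rewrite mulr_ge0 // addr_ge0 ?invr_ge0.
(* For a = 0 the logarithm diverges as r -> 1, but it does not depend on h and [sumD] removes it. *)
have [a0|a0] := eqVneq (nat_of_ord a) 0%N.
  have -> : \sum_h D h * lg r a h = 0.
    rewrite (eq_bigr (fun h => D h * (ln (r ^+ 2 - 2 * 1 * r + 1) / 2))).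
      by rewrite -big_distrl /= sumD mul0r.
    by move=> h _; rewrite /lg a0 mul0n cz0.
  by rewrite normr0 mulr_ge0.
have am : ~~ (m %| a * k)%N.
  rewrite Gauss_dvdl 1?coprime_sym //; apply/negP => /dvdn_leq; have := ltn_ord a; lia.
have -> : \sum_h D h * lg r a h =
  \sum_h D h * ((ln (r * A a h + (1 - r) ^+ 2) - ln (A a h)) / 2).
  have E : \sum_h D h * (ln (A a h) / 2) = 0.
    under eq_bigr do rewrite mulrA.
    rewrite -big_distrl /= (_ : \sum_h D h * ln (A a h) = 0) ?mul0r // -[RHS](logD am).
    by apply: eq_bigr => h _; rewrite /A mulnCA mulnA [(v h * a)%N]mulnC -mulnA.
  rewrite -[LHS]subr0 -[X in _ - X = _]E -sumrB.
  apply: eq_bigr => h _; rewrite /lg /A.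
  have -> : r ^+ 2 - 2 * cz (a * (v h * k)) * r + 1 =
     r * (2 - 2 * cz (a * (v h * k))) + (1 - r) ^+ 2 by ring.
  ring.
apply: le_trans (ler_norm_sum _ _ _) _; rewrite big_distrr /=; apply: ler_sum => h _.
rewrite normrM mulrCA ler_wpM2l // normrM.
have Ap : 0 < A a h.
  rewrite lt_neqAle A0 andbT eq_sym /A; apply/negP => /eqP H.
  have /eqP : cz (a * (v h * k)) = 1 by lra.
  rewrite cz_eq1 mulnCA Gauss_dvdr; last by rewrite coprime_sym.
  by rewrite (negPf am).
have := ln_near_circle Ap rr; rewrite normfV [`|2|]ger0_norm //; move: (normr_ge0 (ln (r * A a h + (1 - r) ^+ 2) - ln (A a h))).
move: (`|_ - _|) ((1 - r) * _) => x y; lra.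
Qed.

Lemma Lsum_inv_fun_bound M : (forall n, `|inv_fun n| <= M) -> forall N,
  `|Lsum inv_fun k N| <= 2 * (m%:R * M) / N.+1%:R.
Proof.
move=> FM N; set B := 2 * (m%:R * M).
have [C HC] := Lr_W_bound; have [C2 C20 HC2] := W_small.
have mp : 0 < m%:R :> R by rewrite ltr0n.
(* With r fixed, compare [Lr r N] with [Lr r N'] by Abel's inequality, and the latter with -[W r] /
   m; then N' -> oo. *)
have step r : 1 / 2 <= r < 1 -> m%:R * `|Lr r N| <= m%:R * (B / N.+1%:R) + (1 - r) * C2.
  move=> rr; have r1 : 0 < 1 - r by move: rr; lra.
  have r0 : 0 < r by move: rr; lra.
  have r01 : 0 <= r < 1 by move: rr; lra.
  apply: (@le_of_le_add_div _ _ _ (`|C| * (2 * (1 - r)^-1 / (1 - r) ^+ 2)) N) => N' NN'.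
  have tail : `|Lr r N' - Lr r N| <= B / N.+1%:R.
    rewrite /Lr [\sum_(1 <= n < N'.+1) _](big_cat_nat (n := N.+1)) //= addrAC subrr add0r.
    have -> : \sum_(N.+1 <= n < N'.+1) r ^+ n * inv_fun (k * n) / n%:R =
       \sum_(N.+1 <= n < N'.+1) inv_fun (k * n) * (r ^+ n / n%:R).
      by apply: eq_bigr => n _; ring.
    have B0 : 0 <= B.
      by rewrite /B !mulr_ge0 //; apply: le_trans (FM 0%N).
    apply: le_trans (_ : _ <= B * (r ^+ N.+1 / N.+1%:R)) _.
      apply: (@abel_bound R (fun n => inv_fun (k * n)) (fun n => r ^+ n / n%:R)).
        exact: (balanced_partial_sums m_gt0 (balanced_mul m_gt0 k inv_fun_balanced)).
      case=> // n _; apply/andP; split.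
        by rewrite divr_ge0 // exprn_ge0 // ltW.
      rewrite ler_pM ?exprn_ge0 ?invr_ge0 ?(ltW r0) //.
        by apply: ler_wiXn2l; rewrite ?ltW //; move: rr; lra.
      by rewrite lef_pV2 ?posrE ?ltr0n // ler_nat.
    rewrite ler_wpM2l // -[leRHS]mul1r ler_wpM2r ?invr_ge0 //.
    by apply: exprn_ile1; [exact: ltW | move: rr; lra].
  (* The sum of r^i over i <= N' lies between (N' + 1) r^N' and 1/(1 - r). *)
  have rN : r ^+ N' <= (1 - r)^-1 / N'.+1%:R.
    rewrite ler_pdivlMr ?ltr0n // -[leRHS]mul1r -ler_pdivrMr ?invr_gt0 // invrK.
    have : r ^+ N' * N'.+1%:R <= \sum_(i < N'.+1) r ^+ i.
      rewrite mulr_natr -[leLHS](_ : \sum_(i < N'.+1) r ^+ N' = _).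
        apply: ler_sum => i _; apply: ler_wiXn2l; rewrite ?(ltW r0) //.
          by move: rr; lra.
        by rewrite -ltnS.
      by rewrite sumr_const card_ord.
    move/(ler_wpM2r (ltW r1)) => H; apply: le_trans H _.
    rewrite mulrC -opprB mulNr -subrX1 opprB lerBlDr lerDl.
    by rewrite exprn_ge0 // ltW.
  have H1 : m%:R * `|Lr r N'| <= (1 - r) * C2 +
       `|C| * (2 * (1 - r)^-1 / (1 - r) ^+ 2) / N'.+1%:R.
    rewrite -[m%:R]ger0_norm // -normrM.
    have -> : m%:R * Lr r N' = (m%:R * Lr r N' + W r) - W r by ring.
    apply: le_trans (ler_normB _ _) _; rewrite [leRHS]addrC; apply: lerD; last exact: HC2.
    apply: le_trans (HC r N' r01) _.
    apply: (@le_trans _ _ (`|C| * (2 * r ^+ N' / (1 - r) ^+ 2))).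
      by rewrite ler_wpM2r ?ler_norm // divr_ge0 ?sqr_ge0 // mulr_ge0 // exprn_ge0 // ltW.
    have -> : `|C| * (2 * (1 - r)^-1 / (1 - r) ^+ 2) / N'.+1%:R =
              `|C| * (2 * ((1 - r)^-1 / N'.+1%:R) / (1 - r) ^+ 2) by ring.
    by rewrite ler_wpM2l // ler_wpM2r ?invr_ge0 ?sqr_ge0 // ler_wpM2l.
  rewrite -addrA; apply: (@le_trans _ _ (m%:R * (B / N.+1%:R + `|Lr r N'|))).
    rewrite ler_wpM2l // -[Lr r N](subrK (Lr r N')); apply: le_trans (ler_normD _ _) _.
    by rewrite lerD2r distrC.
  by rewrite mulrDr lerD2l.
rewrite -(ler_pM2l mp).
pose C3 := \sum_(1 <= n < N.+1) `|inv_fun (k * n)|.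
apply: (@le_of_le_add_div _ _ _ (C2 + m%:R * C3) 0) => J _.
(* Now r tends to 1; the shift by 2 keeps r >= 1/2, as [W_small] requires. *)
pose r : R := 1 - J.+2%:R^-1.
have J1 : 0 < J.+2%:R^-1 :> R by rewrite invr_gt0 ltr0n.
have J2 : J.+2%:R^-1 <= 1 / 2 :> R.
  by rewrite div1r lef_pV2 ?posrE ?ltr0n // ler_nat.
have rr : 1 / 2 <= r < 1 by rewrite /r; move: (_^-1) J1 J2 => x x0 x1; lra.
have r_def : 1 - r = J.+2%:R^-1 by rewrite /r; ring.
clearbody r.
(* Bernoulli gives 1 - r^n <= n (1 - r), which cancels the denominator n. *)
have diff : `|Lsum inv_fun k N - Lr r N| <= (1 - r) * C3.
  rewrite /Lsum /Lr /C3 -sumrB big_distrr /=; apply: le_trans (ler_norm_sum _ _ _) _.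
  apply: ler_sum_nat => n /andP[n0 _].
  have -> : inv_fun (k * n) / n%:R - r ^+ n * inv_fun (k * n) / n%:R =
     (1 - r ^+ n) / n%:R * inv_fun (k * n) by ring.
  rewrite normrM ler_wpM2r //.
  have rn1 : r ^+ n <= 1 by apply: exprn_ile1; move: rr; lra.
  rewrite ger0_norm; last by rewrite divr_ge0 // subr_ge0.
  rewrite ler_pdivrMr ?ltr0n //.
  have := @bernoulli R (r - 1) n; rewrite [1 + (r - 1)]addrC subrK => H.
  have /H : -1 <= r - 1 by move: rr; lra.
  nra.
have H := step r rr.
apply: (@le_trans _ _ (m%:R * (`|Lr r N| + (1 - r) * C3))).
  rewrite ler_wpM2l //.
  have := ler_normD (Lsum inv_fun k N - Lr r N) (Lr r N); rewrite subrK.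
  by move/le_trans; apply; rewrite addrC lerD2l.
have C30 : 0 <= C3 by rewrite sumr_ge0.
have -> : (C2 + m%:R * C3) / J.+1%:R = J.+1%:R^-1 * (C2 + m%:R * C3) by rewrite mulrC.
have : (1 - r) * (C2 + m%:R * C3) <= J.+1%:R^-1 * (C2 + m%:R * C3).
  apply: ler_wpM2r; first by rewrite addr_ge0 ?mulr_ge0.
  by rewrite r_def lef_pV2 ?posrE ?ltr0n // ler_nat.
move: H; move: (m%:R * (B / _)) (_^-1 * _) => x y; nra.
Qed.

End UnitCircle.

(** * The relation between cyclotomic units *)

(** X^n - 1 is separable, so it has n distinct roots, one of which must be primitive. *)
Lemma closed_prim_root_exists (F : closedFieldType) n : (n%:R : F) != 0 ->
  exists z : F, n.-primitive_root z.
Proof.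
move=> nF; have n_gt0 : (0 < n)%N by case: n nF; rewrite ?eqxx.
pose p : {poly F} := 'X^n - 1; have [r Dp] := closed_field_poly_normal p.
rewrite (monicP _) ?monicXnsubC // scale1r in Dp.
have rn1 : all n.-unity_root r by apply/allP => z; rewrite -root_prod_XsubC -Dp.
have sz_r : (n < (size r).+1)%N.
  by rewrite -(size_prod_XsubC r id) -Dp size_XnsubC.
have [|z] := hasP (has_prim_root n_gt0 rn1 _ sz_r); last by exists z.
by rewrite -separable_prod_XsubC -Dp separable_Xn_sub_1.
Qed.

Lemma ln_prodX (R : realType) (T : finType) (x : T -> R) (e : T -> nat) :
  (forall h, 0 < x h) -> ln (\prod_h x h ^+ e h) = \sum_h (e h)%:R * ln (x h).
Proof.
move=> x0; suff [] : 0 < \prod_h x h ^+ e h /\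
  ln (\prod_h x h ^+ e h) = \sum_h (e h)%:R * ln (x h) by [].
elim/big_rec2: _ => [|h y1 y2 _ [y0 E]]; first by rewrite ln1.
by rewrite mulr_gt0 ?exprn_gt0 // lnM ?posrE ?exprn_gt0 // lnXn // E mulr_natl.
Qed.

Section CyclotomicRelation.
Variable m : nat.
Hypothesis m_gt1 : (1 < m)%N.
Implicit Types h : {unit 'Z_m}.

Let rep h : nat := val h.

Let m_gt0 : (0 < m)%N. Proof. exact: ltnW. Qed.

Lemma rep_lt h : (rep h < m)%N.
Proof. by rewrite /rep -[X in (_ < X)%N](Zp_cast m_gt1) ltn_ord. Qed.

Lemma rep_coprime h : coprime (rep h) m.
Proof. by rewrite coprime_sym -unitZpE // natr_Zp (valP h). Qed.

Lemma rep_oppu h : (m %| rep (oppu h) + rep h)%N.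
Proof.
rewrite /rep /=; suff E n (i : nat) : n = m -> (i < n)%N -> (m %| (n - i) %% n + i)%N.
  by apply: E (Zp_cast m_gt1) (ltn_ord _).
move=> -> im; rewrite /dvdn modnDml subnK ?modnn //; exact: ltnW.
Qed.

Lemma oppuK : involutive (@oppu m).
Proof. by move=> h; apply: val_inj; rewrite /= opprK. Qed.

Lemma rep_inj : injective rep.
Proof. by move=> h h' E; apply/val_inj/val_inj. Qed.


Variables f g : {ffun {unit 'Z_m} -> int}.
Hypothesis prod_fg : \prod_(h : {unit 'Z_m}) cycfac h ^ f h
                   = \prod_(h : {unit 'Z_m}) cycfac h ^ g h.

(** Multiplying by the unit factors to the power |f h| + |g h| makes all exponents nonnegative, so
    that the relation lifts to polynomials and can be evaluated. *)
Lemma cycfac_nat_relation : exists a b : {unit 'Z_m} -> nat,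
  (forall h, (a h)%:Z - (b h)%:Z = f h - g h) /\
  \prod_h cycfac h ^+ a h = \prod_h cycfac h ^+ b h.
Proof.
pose N h : nat := (absz (f h) + absz (g h))%N.
exists (fun h => absz (f h + (N h)%:Z)), (fun h => absz (g h + (N h)%:Z)).
have fN h : (absz (f h + (N h)%:Z))%:Z = f h + (N h)%:Z by rewrite /N; lia.
have gN h : (absz (g h + (N h)%:Z))%:Z = g h + (N h)%:Z by rewrite /N; lia.
split=> [h|]; first by rewrite fN gN; lia.
have E (k : {ffun {unit 'Z_m} -> int}) (c : {unit 'Z_m} -> nat) :
    (forall h, (c h)%:Z = k h + (N h)%:Z) ->
  \prod_h cycfac h ^+ c h = (\prod_h cycfac h ^ k h) * \prod_h cycfac h ^+ N h.
  move=> H; rewrite -big_split /=; apply: eq_bigr => h _.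
  by rewrite exprnP H exprzDr ?cycfac_unit.
by rewrite (E f _ fN) (E g _ gN) prod_fg.
Qed.

Lemma cycfacE h : cycfac h = in_qpoly (Cpoly m) ('X^(rep h) - 1).
Proof. by rewrite /cycfac /xC rmorphB rmorphXn rmorph1. Qed.

Lemma Cpoly_dvd_of_in_qpoly (p q : {poly rat}) :
  in_qpoly (Cpoly m) p = in_qpoly (Cpoly m) q -> exists r, p - q = r * Cpoly m.
Proof.
have CE := mk_monic_Cpoly m_gt1.
have mon : Cpoly m \is monic by rewrite -CE monic_mk_monic.
move=> E; have : val (in_qpoly (Cpoly m) (p - q)) = 0.
  by rewrite [in_qpoly _ _]raddfB; have /eqP := E; rewrite -subr_eq0 => /eqP ->.
rewrite /= CE => H; exists (Pdiv.Ring.rdivp (p - q) (Cpoly m)).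
by rewrite {1}(Pdiv.RingMonic.rdivp_eq mon (p - q)) H addr0.
Qed.

Variables (R : realType) (z : R[i]).
Hypothesis z_prim : m.-primitive_root z.

Lemma norm_prim_root_sub1 j : `|z ^+ j - 1| ^+ 2 = (2 - 2 * cz z j)%:C%C.
Proof.
rewrite -add_Re2_Im2; congr (_%:C)%C; have := circle_Re_Im m_gt1 z_prim j.
rewrite /cz; case: (z ^+ j) => x y /= H; rewrite subr0.
have -> : y ^+ 2 = 1 - x ^+ 2 by rewrite -H addrC addKr.
ring.
Qed.

(** Lift the relation to rational polynomials modulo [Cpoly m] and evaluate at z^a, a root of
    [Cpoly m] because z^a <> 1. Squared absolute values turn the factors into positive reals, whose
    logarithms are then taken. *)
Lemma log_relation a : ~~ (m %| a)%N ->
  \sum_h (f h - g h)%:~R * ln (2 - 2 * cz z (rep h * a)) = 0.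
Proof.
move=> ma; have [c [d [cd E]]] := cycfac_nat_relation.
have za1 : z ^+ a != 1 by rewrite -(prim_order_dvd z_prim).
have [r Er] : exists r : {poly rat},
   \prod_h ('X^(rep h) - 1) ^+ c h - \prod_h ('X^(rep h) - 1) ^+ d h = r * Cpoly m.
  apply: Cpoly_dvd_of_in_qpoly; move: E.
  under eq_bigr do rewrite cycfacE -rmorphXn.
  under [RHS]eq_bigr do rewrite cycfacE -rmorphXn.
  by rewrite -!rmorph_prod.
have C0 : (map_poly (ratr : rat -> R[i]) (Cpoly m)).[z ^+ a] = 0.
  apply: (@mulfI _ (z ^+ a - 1)); first by rewrite subr_eq0.
  rewrite mulr0 /Cpoly rmorph_sum horner_sum.
  under eq_bigr do rewrite /= map_polyXn hornerXn.
  by rewrite -subrX1 -exprM mulnC exprM (prim_expr_order z_prim) expr1n subrr.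
have evalE (e : {unit 'Z_m} -> nat) :
   (map_poly (ratr : rat -> R[i]) (\prod_h ('X^(rep h) - 1) ^+ e h)).[z ^+ a] =
   \prod_h (z ^+ (rep h * a) - 1) ^+ e h.
  rewrite rmorph_prod horner_prod; apply: eq_bigr => h _.
  rewrite rmorphXn rmorphB /= map_polyXn rmorph1 horner_exp !hornerE.
  by rewrite -exprM mulnC.
have Ez : \prod_h (z ^+ (rep h * a) - 1) ^+ c h = \prod_h (z ^+ (rep h * a) - 1) ^+ d h.
  apply/eqP; rewrite -subr_eq0 -!evalE -hornerN -hornerD -rmorphB.
  by rewrite Er rmorphM hornerM C0 mulr0.
pose x h : R := 2 - 2 * cz z (rep h * a).
have x0 h : 0 < x h.
  have := cz_le1 m_gt1 z_prim (rep h * a); rewrite ler_norml => /andP[_ c1].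
  have : cz z (rep h * a) != 1.
    by rewrite (cz_eq1 m_gt1 z_prim) Gauss_dvdr // coprime_sym rep_coprime.
  rewrite /x; move: (cz _ _) c1 => y y1 ny; have : y < 1 by rewrite lt_neqAle ny.
  lra.
have normE (e : {unit 'Z_m} -> nat) :
   `|\prod_h (z ^+ (rep h * a) - 1) ^+ e h| ^+ 2 = (\prod_h x h ^+ e h)%:C%C.
  rewrite normr_prod -prodrXl rmorph_prod; apply: eq_bigr => h _.
  by rewrite normrX exprAC norm_prim_root_sub1 rmorphXn.
have : \prod_h x h ^+ c h = \prod_h x h ^+ d h.
  by apply: complexI; rewrite -!normE Ez.
move/(congr1 (@ln R)); rewrite !ln_prodX // => H.
rewrite -[RHS](subrr (\sum_h (d h)%:R * ln (x h))) -{1}H -sumrB.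
apply: eq_bigr => h _; rewrite -mulrBl -cd rmorphB /=; congr (_ * _).
Qed.

End CyclotomicRelation.

(** * Combining the logarithmic relation with the vanishing theorem *)

Theorem mainTheorem9 (m : nat) (m_gt1 : (1 < m)%N)
    (m_mod4 : (m <> 2 %[mod 4])%N)
    (f g : {ffun {unit 'Z_m} -> int})
    (f_even : even_fun f) (g_even : even_fun g)
    (sum_fg : \sum_(h : {unit 'Z_m}) f h = \sum_(h : {unit 'Z_m}) g h)
    (prod_fg : \prod_(h : {unit 'Z_m}) cycfac h ^ f h
               = \prod_(h : {unit 'Z_m}) cycfac h ^ g h) :
  f = g.
Proof.
(* The statement is over the rationals; the analysis takes place in one chosen model of the
   reals. *)
pose R := Rdefinitions.R : realType.
have m_gt0 := ltnW m_gt1.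
have [z z_prim] : exists z : R[i], m.-primitive_root z.
  by apply: closed_prim_root_exists; rewrite pnatr_eq0 -lt0n.
pose rep (h : {unit 'Z_m}) : nat := val h.
pose D h : R := (f h - g h)%:~R.
have sumD : \sum_h D h = 0.
  by rewrite /D -rmorph_sum sumrB sum_fg subrr.
(* Replacing h by -h exchanges the residues 1 and -1 of [rep h * n]. *)
have evenD n : \sum_h D h * (m %| rep h * n + 1)%:R = inv_fun m rep D n.
  rewrite (reindex_inj (inv_inj (@oppuK m))) /=; apply: eq_bigr => h _.
  rewrite /D f_even g_even; congr (_ * _%:R); congr nat_of_bool.
  have E : (m %| (rep (oppu h) * n + 1) + (rep h * n + m.-1))%N.
    have -> : ((rep (oppu h) * n + 1) + (rep h * n + m.-1) =
               (rep (oppu h) + rep h) * n + m)%N by nia.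
    by rewrite dvdn_add // dvdn_mulr // rep_oppu.
  by apply/idP/idP => H; [rewrite -(dvdn_addr _ H) | rewrite -(dvdn_addl _ H)].
have logD := log_relation m_gt1 prod_fg z_prim.
have rep_cop := rep_coprime m_gt1.
have balF : balanced m (inv_fun m rep D) by apply: inv_fun_balanced.
have LF : Lvanish (inv_fun m rep D).
  have [M M0 FM] : exists2 M, 0 <= M & forall n, `|inv_fun m rep D n| <= M.
    by apply: (periodic_bounded m_gt0); case: balF.
  exists (2 * (m%:R * M)); first by rewrite !mulr_ge0.
  (* For k not prime to m every term of the sum is 0. *)
  move=> k N; have [km|km] := boolP (coprime k m).
    exact: (Lsum_inv_fun_bound m_gt1 z_prim).
  rewrite /Lsum big1 => [|n _]; first by rewrite normr0 divr_ge0 ?mulr_ge0.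
  by case: balF => _ -> //; rewrite ?mul0r // coprimeMl (negPf km).
have intF n : exists y : int, inv_fun m rep D n = y%:~R.
  exists (\sum_h (f h - g h) * (m %| rep h * n + m.-1)%:Z).
  rewrite rmorph_sum; apply: eq_bigr => h _; rewrite rmorphM; congr (_ * _).
have F0 := Lvanish_eq0 m_gt0 balF intF LF.
apply/ffunP => h0; apply/eqP; rewrite -subr_eq0 -(intr_eq0 R) -/(D h0).
(* At the inverse n of [h0] the sum [inv_fun] reduces to the single term [D h0]. *)
have [n Hn] : exists n, (rep h0 * n = 1 %[mod m])%N.
  exists (val (val h0)^-1).
  suff E n : (Zp_trunc m).+2 = n -> (rep h0 * val (val h0)^-1 = 1 %[mod n])%N.
    by apply: E; apply: Zp_cast.
  by move=> <-; have /(congr1 val) := divrr (valP h0).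
have dvdE h : (m %| rep h * n + m.-1)%N = (h == h0).
  have -> : (m %| rep h * n + m.-1)%N = (rep h * n == 1 %[mod m])%N.
    rewrite -(eqn_modDr m.-1) add1n prednK // modnn //.
  apply/eqP/eqP => [H|->]; last exact: Hn.
  apply: (@rep_inj m); apply: (@coprime_mulmod_inj m m_gt0 n).
  - have : coprime (rep h0 * n) m by rewrite -coprime_modl Hn coprime_modl coprime1n.
    by rewrite coprimeMl => /andP[].
  - exact: rep_lt.
  - exact: rep_lt.
  - by rewrite ![(n * _)%N]mulnC H Hn.
have := F0 n; rewrite /inv_fun (bigD1 h0) //= dvdE eqxx mulr1 big1 ?addr0 => [-> //|h].
by rewrite dvdE => /negPf ->; rewrite mulr0.
Qed.
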